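(* Let $\mathsf{C}$ be a strict symmetric monoidal category and let $H$, $A$, $X$ be Hopf quasigroups in $\mathsf{C}$ such that the antipodes of $H$ and $A$ are isomorphisms. Then $X$ factorizes as $X=AH$ if and only if there exists a matched pair of Hopf quasigroups $(A,H)$ such that $X$ is isomorphic to the double cross product $A\bowtie H$ as Hopf quasigroups.
   Context: $\mathsf{C}$ is a strict symmetric monoidal category with tensor product $\otimes$, unit object $K$ and symmetry $c$. For an object $P$ and a morphism $f$, write $P\otimes f$ for $id_P\otimes f$ and $f\otimes P$ for $f\otimes id_P$. Unital magma: $(A,\eta_A:K\to A,\mu_A:A\otimes A\to A)$ with $\mu_A\circ(A\otimes\eta_A)=id_A=\mu_A\circ(\eta_A\otimes A)$ (no associativity required). Comonoid: $(D,\varepsilon_D,\delta_D)$, counital and coassociative. For unital magmas $A,B$ and comonoids $D,E$: $\eta_{A\otimes B}=\eta_A\otimes\eta_B$, $\mu_{A\otimes B}=(\mu_A\otimes\mu_B)\circ(A\otimes c_{B,A}\otimes B)$, $\varepsilon_{D\otimes E}=\varepsilon_D\otimes\varepsilon_E$, $\delta_{D\otimes E}=(D\otimes c_{D,E}\otimes E)\circ(\delta_D\otimes\delta_E)$. Morphisms of unital magmas preserve unit and product; morphisms of comonoids preserve counit and coproduct. Hopf quasigroup $H$ in $\mathsf{C}$: a unital magma $(H,\eta_H,\mu_H)$ and comonoid $(H,\varepsilon_H,\delta_H)$ such that $\varepsilon_H$ and $\delta_H$ are morphisms of unital magmas, together with a morphism $\lambda_H:H\to H$ (antipode) such that $$\mu_H\circ(\lambda_H\otimes\mu_H)\circ(\delta_H\otimes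 H)=\varepsilon_H\otimes H=\mu_H\circ(H\otimes\mu_H)\circ(H\otimes\lambda_H\otimes H)\circ(\delta_H\otimes H),$$ $$\mu_H\circ(\mu_H\otimes H)\circ(H\otimes\lambda_H\otimes H)\circ(H\otimes\delta_H)=H\otimes\varepsilon_H=\mu_H\circ(\mu_H\otimes\lambda_H)\circ(H\otimes\delta_H).$$ A morphism of Hopf quasigroups is a morphism of unital magmas and comonoids. Factorization: $X$ factorizes as $X=AH$ if $A$ and $H$ are Hopf subquasigroups of $X$, i.e. there are inclusion morphisms $i_A:A\to X$, $i_H:H\to X$ (monomorphisms in $\mathsf{C}$ that are morphisms of Hopf quasigroups), such that, writing $\omega_X=\mu_X\circ(i_A\otimes i_H):A\otimes H\to X$ and $\theta_X=\mu_X\circ(i_H\otimes i_A):H\otimes A\to X$, the morphism $\omega_X$ is an isomorphism and 1. $\mu_X\circ(\omega_X\otimes X)=\mu_X\circ(i_A\otimes(\mu_X\circ(i_H\otimes X)))$, 2. $\mu_X\circ(X\otimes\omega_X)=\mu_X\circ((\mu_X\circ(X\otimes i_A))\otimes i_H)$, 3. $\mu_X\circ((\theta_X\circ(\lambda_H\otimes\lambda_A))\otimes X)=\mu_X\circ((i_H\circ\lambda_H)\otimes(\mu_X\circ((i_A\circ\lambda_A)\otimes X)))$, 4. $\mu_X\circ(X\otimes(\theta_X\circ(\lambda_H\otimes\lambda_A)))=\mu_X\circ((\mu_X\circ(X\otimes(i_H\circ\lambda_H)))\otimes(i_A\circ\lambda_A))$. Left $H$-module comonoid $(A,\varphi_A)$,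 $\varphi_A:H\otimes A\to A$: $\varphi_A\circ(\eta_H\otimes A)=id_A$, $\varphi_A\circ(H\otimes\varphi_A)=\varphi_A\circ(\mu_H\otimes A)$, $\varepsilon_A\circ\varphi_A=\varepsilon_H\otimes\varepsilon_A$, $\delta_A\circ\varphi_A=(\varphi_A\otimes\varphi_A)\circ\delta_{H\otimes A}$. Right $A$-module comonoid $(H,\phi_H)$, $\phi_H:H\otimes A\to H$: $\phi_H\circ(H\otimes\eta_A)=id_H$, $\phi_H\circ(\phi_H\otimes A)=\phi_H\circ(H\otimes\mu_A)$, $\varepsilon_H\circ\phi_H=\varepsilon_H\otimes\varepsilon_A$, $\delta_H\circ\phi_H=(\phi_H\otimes\phi_H)\circ\delta_{H\otimes A}$. Matched pair of Hopf quasigroups $(A,H)$: Hopf quasigroups $A$, $H$ with a left $H$-module comonoid structure $(A,\varphi_A)$ and a right $A$-module comonoid structure $(H,\phi_H)$ such that, with $\Psi=(\varphi_A\otimes\phi_H)\circ\delta_{H\otimes A}:H\otimes A\to A\otimes H$, - $\varphi_A\circ(H\otimes\eta_A)=\varepsilon_H\otimes\eta_A$, $\quad\phi_H\circ(\eta_H\otimes A)=\eta_H\otimes\varepsilon_A$, - $(\phi_H\otimes\varphi_A)\circ\delta_{H\otimes A}=c_{A,H}\circ\Psi$, - $\varphi_A\circ(H\otimes\mu_A)\circ(\lambda_H\otimes\lambda_A\otimes A)=\mu_A\circ(A\otimes\varphi_A)\circ((\Psi\circ(\lambda_H\otimes\lambda_A))\otimes A)$, - $\mu_H\circ(\phi_H\otimes\mu_H)\circ(\lambda_H\otimes\Psi\otimes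 H)\circ(\delta_H\otimes A\otimes H)=\varepsilon_H\otimes\varepsilon_A\otimes H$, - $\mu_H\circ(\phi_H\otimes\mu_H)\circ(H\otimes\Psi\otimes H)\circ(((H\otimes\lambda_H)\circ\delta_H)\otimes A\otimes H)=\varepsilon_H\otimes\varepsilon_A\otimes H$, - $\phi_H\circ(\mu_H\otimes A)\circ(H\otimes\lambda_H\otimes\lambda_A)=\mu_H\circ(\phi_H\otimes H)\circ(H\otimes(\Psi\circ(\lambda_H\otimes\lambda_A)))$, - $\mu_A\circ(\mu_A\otimes\varphi_A)\circ(A\otimes\Psi\otimes\lambda_A)\circ(A\otimes H\otimes\delta_A)=A\otimes\varepsilon_H\otimes\varepsilon_A$, - $\mu_A\circ(\mu_A\otimes\varphi_A)\circ(A\otimes\Psi\otimes A)\circ(A\otimes H\otimes((\lambda_A\otimes A)\circ\delta_A))=A\otimes\varepsilon_H\otimes\varepsilon_A$. Double cross product: for a matched pair $(A,H)$, $A\bowtie H$ is the object $A\otimes H$ with product $(\mu_A\otimes\mu_H)\circ(A\otimes\Psi\otimes H)$, unit $\eta_A\otimes\eta_H$, counit $\varepsilon_{A\otimes H}$, coproduct $\delta_{A\otimes H}$ and antipode $\Psi\circ(\lambda_H\otimes\lambda_A)\circ c_{A,H}$; it is known to be a Hopf quasigroup. *)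

(* Defs.v *)
From mathcomp Require Import ssreflect ssrfun ssrbool.

Set Implicit Arguments.
Unset Strict Implicit.
Unset Printing Implicit Defensive.

Declare Scope obj_scope.
Declare Scope arr_scope.
Delimit Scope obj_scope with ob.
Delimit Scope arr_scope with ar.

Reserved Notation "g ∘ f" (at level 50, left associativity).
Reserved Notation "A ⊗ B" (at level 40, left associativity).

(* A category is given by its objects, its arrows and the maps dom and cod, so
   that the strict laws of the tensor product on arrows are plain equations,
   with no transport along equalities of objects.  The function comp is total,
   but comp g f is constrained, and used, only when dom g = cod f. *)
Record ssm_category := SSMCategory {
  obj : Type;
  arr : Type;
  dom : arr -> obj;
  cod : arr -> obj;
  idm : obj -> arr;
  comp : arr -> arr -> arr;
  dom_idm : forall A, dom (idm A) = A;
  cod_idm : forall A, cod (idm A) = A;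
  dom_comp : forall g f, dom g = cod f -> dom (comp g f) = dom f;
  cod_comp : forall g f, dom g = cod f -> cod (comp g f) = cod g;
  comp_idl : forall f, comp (idm (cod f)) f = f;
  comp_idr : forall f, comp f (idm (dom f)) = f;
  compA : forall h g f, dom h = cod g -> dom g = cod f ->
    comp h (comp g f) = comp (comp h g) f;
  (* strict monoidal structure *)
  unit_obj : obj;
  tens : obj -> obj -> obj;
  tensm : arr -> arr -> arr;
  dom_tensm : forall f g, dom (tensm f g) = tens (dom f) (dom g);
  cod_tensm : forall f g, cod (tensm f g) = tens (cod f) (cod g);
  tensm_id : forall A B, tensm (idm A) (idm B) = idm (tens A B);
  tensm_comp : forall g f g' f', dom g = cod f -> dom g' = cod f' ->
    tensm (comp g f) (comp g' f') = comp (tensm g g') (tensm f f');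
  tensA : forall A B D, tens A (tens B D) = tens (tens A B) D;
  tens1o : forall A, tens unit_obj A = A;
  tenso1 : forall A, tens A unit_obj = A;
  tensmA : forall f g h, tensm f (tensm g h) = tensm (tensm f g) h;
  tensm1a : forall f, tensm (idm unit_obj) f = f;
  tensma1 : forall f, tensm f (idm unit_obj) = f;
  (* symmetry; the compatibility of braid with the unit object and the second
     hexagon follow from the laws below *)
  braid : obj -> obj -> arr;
  dom_braid : forall A B, dom (braid A B) = tens A B;
  cod_braid : forall A B, cod (braid A B) = tens B A;
  braid_natural : forall f g,
    comp (tensm g f) (braid (dom f) (dom g)) =
    comp (braid (cod f) (cod g)) (tensm f g);
  braidK : forall A B, comp (braid B A) (braid A B) = idm (tens A B);
  braid_hexagon : forall A B D,
    braid A (tens B D) =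
    comp (tensm (idm B) (braid A D)) (tensm (braid A B) (idm D))
}.

Bind Scope obj_scope with obj.
Bind Scope arr_scope with arr.
Arguments unit_obj {s}.
Arguments dom {s} f%_ar : rename.
Arguments cod {s} f%_ar : rename.
Arguments idm {s} A%_ob : rename.
Arguments comp {s} g%_ar f%_ar : rename.
Arguments tens {s} A%_ob B%_ob : rename.
Arguments tensm {s} f%_ar g%_ar : rename.
Arguments braid {s} A%_ob B%_ob : rename.

Notation K := unit_obj.
Notation "A ⊗ B" := (tens A B) : obj_scope.
Notation "f ⊗ g" := (tensm f g) : arr_scope.
Notation "g ∘ f" := (comp g f) : arr_scope.

(* An object used as an arrow stands for its identity, as in P ⊗ f. *)
Coercion idm : obj >-> arr.

Open Scope arr_scope.

Definition hom (C : ssm_category) (A B : obj C) (f : arr C) : Prop :=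
  dom f = A /\ cod f = B.

Definition isomorphism (C : ssm_category) (A B : obj C) (f : arr C) : Prop :=
  hom A B f /\ exists g : arr C, [/\ hom B A g, g ∘ f = idm A & f ∘ g = idm B].

Definition monomorphism (C : ssm_category) (A B : obj C) (f : arr C) : Prop :=
  hom A B f /\
  forall (D : obj C) (g h : arr C),
    hom D A g -> hom D A h -> f ∘ g = f ∘ h -> g = h.

Record magma_data (C : ssm_category) := MagmaData {
  mcarrier :> obj C;
  eta : arr C;
  mu : arr C
}.

Record unital_magma (C : ssm_category) (A : magma_data C) : Prop := UnitalMagma {
  eta_hom : hom K A (eta A);
  mu_hom : hom (A ⊗ A) A (mu A);
  mu_eta_r : mu A ∘ (A ⊗ eta A) = idm A;
  mu_eta_l : mu A ∘ (eta A ⊗ A) = idm A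
}.

Record magma_morphism (C : ssm_category) (A B : magma_data C) (f : arr C)
    : Prop := MagmaMorphism {
  magma_morphism_hom : hom A B f;
  magma_morphism_eta : f ∘ eta A = eta B;
  magma_morphism_mu : f ∘ mu A = mu B ∘ (f ⊗ f)
}.

Definition unit_magma (C : ssm_category) : magma_data C :=
  MagmaData K (idm K) (idm K).

Definition tens_magma (C : ssm_category) (A B : magma_data C) : magma_data C :=
  MagmaData (A ⊗ B) (eta A ⊗ eta B) ((mu A ⊗ mu B) ∘ (A ⊗ braid B A ⊗ B)).

Record comonoid_data (C : ssm_category) := ComonoidData {
  ccarrier :> obj C;
  eps : arr C;
  delta : arr C
}.

Record comonoid (C : ssm_category) (D : comonoid_data C) : Prop := Comonoid {
  eps_hom : hom D K (eps D);
  delta_hom : hom D (D ⊗ D) (delta D);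
  delta_eps_l : (eps D ⊗ D) ∘ delta D = idm D;
  delta_eps_r : (D ⊗ eps D) ∘ delta D = idm D;
  delta_coassoc : (delta D ⊗ D) ∘ delta D = (D ⊗ delta D) ∘ delta D
}.

Record comonoid_morphism (C : ssm_category) (D E : comonoid_data C) (f : arr C)
    : Prop := ComonoidMorphism {
  comonoid_morphism_hom : hom D E f;
  comonoid_morphism_eps : eps E ∘ f = eps D;
  comonoid_morphism_delta : delta E ∘ f = (f ⊗ f) ∘ delta D
}.

Definition tens_comonoid (C : ssm_category) (D E : comonoid_data C)
    : comonoid_data C :=
  ComonoidData (D ⊗ E) (eps D ⊗ eps E)
    ((D ⊗ braid D E ⊗ E) ∘ (delta D ⊗ delta E)).

Record hopf_data (C : ssm_category) := HopfData {
  hmagma :> magma_data C;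
  heps : arr C;
  hdelta : arr C;
  lam : arr C
}.

Definition hcomonoid (C : ssm_category) (H : hopf_data C) : comonoid_data C :=
  ComonoidData H (heps H) (hdelta H).
Coercion hcomonoid : hopf_data >-> comonoid_data.

Record is_hopf_quasigroup (C : ssm_category) (H : hopf_data C) : Prop :=
  IsHopfQuasigroup {
  hq_unital_magma : unital_magma H;
  hq_comonoid : comonoid H;
  hq_eps_magma : magma_morphism H (unit_magma C) (eps H);
  hq_delta_magma : magma_morphism H (tens_magma H H) (delta H);
  lam_hom : hom H H (lam H);
  lam_l : mu H ∘ (lam H ⊗ mu H) ∘ (delta H ⊗ H) = eps H ⊗ H;
  lam_l' : mu H ∘ (H ⊗ mu H) ∘ (H ⊗ lam H ⊗ H) ∘ (delta H ⊗ H) = eps H ⊗ H;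
  lam_r : mu H ∘ (mu H ⊗ H) ∘ (H ⊗ lam H ⊗ H) ∘ (H ⊗ delta H) = H ⊗ eps H;
  lam_r' : mu H ∘ (mu H ⊗ lam H) ∘ (H ⊗ delta H) = H ⊗ eps H
}.

Record hopf_quasigroup (C : ssm_category) := HopfQuasigroup {
  hq_data :> hopf_data C;
  hopf_quasigroupP : is_hopf_quasigroup hq_data
}.

(* Morphisms involve neither the axioms nor the antipode; they are defined on
   hopf_data so that they apply to the double cross product below. *)
Definition hopf_morphism (C : ssm_category) (H B : hopf_data C) (f : arr C)
    : Prop :=
  magma_morphism H B f /\ comonoid_morphism H B f.

Definition hopf_isomorphic (C : ssm_category) (H B : hopf_data C) : Prop :=
  exists f g : arr C,
    [/\ hopf_morphism H B f, hopf_morphism B H g,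
        g ∘ f = idm H & f ∘ g = idm B].

Section Factorization.

Variables (C : ssm_category) (X A H : hopf_quasigroup C) (iA iH : arr C).

Definition omega : arr C := mu X ∘ (iA ⊗ iH).
Definition theta : arr C := mu X ∘ (iH ⊗ iA).

Record factorization : Prop := Factorization {
  iA_mono : monomorphism A X iA;
  iA_morphism : hopf_morphism A X iA;
  iH_mono : monomorphism H X iH;
  iH_morphism : hopf_morphism H X iH;
  omega_iso : isomorphism (A ⊗ H) X omega;
  omega_mul_l : mu X ∘ (omega ⊗ X) = mu X ∘ (iA ⊗ (mu X ∘ (iH ⊗ X)));
  omega_mul_r : mu X ∘ (X ⊗ omega) = mu X ∘ ((mu X ∘ (X ⊗ iA)) ⊗ iH);
  theta_mul_l :
    mu X ∘ ((theta ∘ (lam H ⊗ lam A)) ⊗ X) =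
    mu X ∘ ((iH ∘ lam H) ⊗ (mu X ∘ ((iA ∘ lam A) ⊗ X)));
  theta_mul_r :
    mu X ∘ (X ⊗ (theta ∘ (lam H ⊗ lam A))) =
    mu X ∘ ((mu X ∘ (X ⊗ (iH ∘ lam H))) ⊗ (iA ∘ lam A))
}.

End Factorization.

Definition factorizes (C : ssm_category) (X A H : hopf_quasigroup C) : Prop :=
  exists iA iH : arr C, factorization X A H iA iH.

Record left_module_comonoid (C : ssm_category) (H : hopf_data C)
    (A : comonoid_data C) (phi : arr C) : Prop := LeftModuleComonoid {
  lmod_hom : hom (H ⊗ A) A phi;
  lmod_eta : phi ∘ (eta H ⊗ A) = idm A;
  lmod_mu : phi ∘ (H ⊗ phi) = phi ∘ (mu H ⊗ A);
  lmod_eps : eps A ∘ phi = eps H ⊗ eps A;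
  lmod_delta : delta A ∘ phi = (phi ⊗ phi) ∘ delta (tens_comonoid H A)
}.

Record right_module_comonoid (C : ssm_category) (A : hopf_data C)
    (H : comonoid_data C) (phi : arr C) : Prop := RightModuleComonoid {
  rmod_hom : hom (H ⊗ A) H phi;
  rmod_eta : phi ∘ (H ⊗ eta A) = idm H;
  rmod_mu : phi ∘ (phi ⊗ A) = phi ∘ (H ⊗ mu A);
  rmod_eps : eps H ∘ phi = eps H ⊗ eps A;
  rmod_delta : delta H ∘ phi = (phi ⊗ phi) ∘ delta (tens_comonoid H A)
}.

Section MatchedPair.

Variables (C : ssm_category) (A H : hopf_quasigroup C) (phiA phiH : arr C).

Definition Psi : arr C := (phiA ⊗ phiH) ∘ delta (tens_comonoid H A).

Record matched_pair : Prop := MatchedPair {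
  mp_left : left_module_comonoid H A phiA;
  mp_right : right_module_comonoid A H phiH;
  mp_eta_A : phiA ∘ (H ⊗ eta A) = eps H ⊗ eta A;
  mp_eta_H : phiH ∘ (eta H ⊗ A) = eta H ⊗ eps A;
  mp_braid : (phiH ⊗ phiA) ∘ delta (tens_comonoid H A) = braid A H ∘ Psi;
  mp_mu_A :
    phiA ∘ (H ⊗ mu A) ∘ (lam H ⊗ lam A ⊗ A) =
    mu A ∘ (A ⊗ phiA) ∘ ((Psi ∘ (lam H ⊗ lam A)) ⊗ A);
  mp_lam_H_l :
    mu H ∘ (phiH ⊗ mu H) ∘ (lam H ⊗ Psi ⊗ H) ∘ (delta H ⊗ A ⊗ H) =
    eps H ⊗ eps A ⊗ H;
  mp_lam_H_r :
    mu H ∘ (phiH ⊗ mu H) ∘ (H ⊗ Psi ⊗ H) ∘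
      (((H ⊗ lam H) ∘ delta H) ⊗ A ⊗ H) =
    eps H ⊗ eps A ⊗ H;
  mp_mu_H :
    phiH ∘ (mu H ⊗ A) ∘ (H ⊗ lam H ⊗ lam A) =
    mu H ∘ (phiH ⊗ H) ∘ (H ⊗ (Psi ∘ (lam H ⊗ lam A)));
  mp_lam_A_r :
    mu A ∘ (mu A ⊗ phiA) ∘ (A ⊗ Psi ⊗ lam A) ∘ (A ⊗ H ⊗ delta A) =
    A ⊗ eps H ⊗ eps A;
  mp_lam_A_l :
    mu A ∘ (mu A ⊗ phiA) ∘ (A ⊗ Psi ⊗ A) ∘
      (A ⊗ H ⊗ ((lam A ⊗ A) ∘ delta A)) =
    A ⊗ eps H ⊗ eps A
}.

Definition double_cross_product : hopf_data C :=
  HopfData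
    (MagmaData (A ⊗ H) (eta A ⊗ eta H) ((mu A ⊗ mu H) ∘ (A ⊗ Psi ⊗ H)))
    (eps (tens_comonoid A H))
    (delta (tens_comonoid A H))
    (Psi ∘ (lam H ⊗ lam A) ∘ braid A H).

End MatchedPair.

(* Main.v *)
(* An isomorphism omega : A ⊗ H -> X turns the product theta of H and A in X into
   psi = omega^-1 ∘ theta : H ⊗ A -> A ⊗ H, and the associativity conditions of
   a factorization say that psi is a distributive law between the (possibly
   nonassociative) products; since theta and omega are morphisms of comonoids,
   so is psi.  The antipodes of A and H being invertible, they can be cancelled
   from the conditions in which they precompose.  A comonoid morphism into
   A ⊗ H is determined by its two components, so psi amounts to the pair
   phiA = (A ⊗ eps) ∘ psi, phiH = (eps ⊗ H) ∘ psi, and the axioms of a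
   distributive law are, component by component, the module and compatibility
   axioms of a matched pair.  The remaining axioms of a matched pair come from
   the antipode of X through omega and one of the two components. *)
From mathcomp Require Import ssreflect ssrfun ssrbool.
Require Import Defs.

Set Implicit Arguments.
Unset Strict Implicit.
Unset Printing Implicit Defensive.

(** * Composability *)

Section Typing.
Variable C : ssm_category.
Implicit Types (A B D : obj C) (f g : arr C).

Lemma hom_dom A B f : hom A B f -> dom f = A. Proof. by case. Qed.
Lemma hom_cod A B f : hom A B f -> cod f = B. Proof. by case. Qed.

Variable H : hopf_quasigroup C.
Let hH := hopf_quasigroupP H.

Lemma hom_eta : hom K H (eta H).
Proof. exact: eta_hom (hq_unital_magma hH). Qed.
Lemma hom_mu : hom (H ⊗ H)%ob H (mu H).
Proof. exact: mu_hom (hq_unital_magma hH). Qed.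
Lemma hom_heps : hom H K (heps H).
Proof. exact: (eps_hom (hq_comonoid hH)). Qed.
Lemma hom_hdelta : hom H (H ⊗ H)%ob (hdelta H).
Proof. exact: (delta_hom (hq_comonoid hH)). Qed.
Lemma hom_lam : hom H H (lam H).
Proof. exact: lam_hom hH. Qed.

End Typing.

(** The substitute for the map into a product induced by [f] and [g]. [Psi] is the pairing of [phiA]
    and [phiH] on the comonoid H ⊗ A. *)
Definition pairing (C : ssm_category) (D : comonoid_data C) (f g : arr C) : arr C :=
  (f ⊗ g) ∘ delta D.

(* Forward declaration: typ_step needs typ to check inner compositions. *)
Ltac typ := fail.

Ltac typ_step :=
  match goal with
  | |- context [dom (idm ?A)] => rewrite (dom_idm A)
  | |- context [cod (idm ?A)] => rewrite (cod_idm A)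
  | |- context [dom (?f ⊗ ?g)] => rewrite (dom_tensm f g)
  | |- context [cod (?f ⊗ ?g)] => rewrite (cod_tensm f g)
  | |- context [dom (?g ∘ ?f)] => rewrite (@dom_comp _ g f); [ | solve [typ]]
  | |- context [cod (?g ∘ ?f)] => rewrite (@cod_comp _ g f); [ | solve [typ]]
  | |- context [dom (braid ?A ?B)] => rewrite (dom_braid A B)
  | |- context [cod (braid ?A ?B)] => rewrite (cod_braid A B)
  | |- context [dom (eta (hmagma (hq_data ?H)))] => rewrite (hom_dom (hom_eta H))
  | |- context [cod (eta (hmagma (hq_data ?H)))] => rewrite (hom_cod (hom_eta H))
  | |- context [dom (mu (hmagma (hq_data ?H)))] => rewrite (hom_dom (hom_mu H))
  | |- context [cod (mu (hmagma (hq_data ?H)))] => rewrite (hom_cod (hom_mu H))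
  | |- context [dom (heps (hq_data ?H))] => rewrite (hom_dom (hom_heps H))
  | |- context [cod (heps (hq_data ?H))] => rewrite (hom_cod (hom_heps H))
  | |- context [dom (hdelta (hq_data ?H))] => rewrite (hom_dom (hom_hdelta H))
  | |- context [cod (hdelta (hq_data ?H))] => rewrite (hom_cod (hom_hdelta H))
  | |- context [dom (lam (hq_data ?H))] => rewrite (hom_dom (hom_lam H))
  | |- context [cod (lam (hq_data ?H))] => rewrite (hom_cod (hom_lam H))
  | h : dom ?f = _ |- context [dom ?f] => rewrite h
  | h : cod ?f = _ |- context [cod ?f] => rewrite h
  | h : hom _ _ ?f |- context [dom ?f] => rewrite (hom_dom h)
  | h : hom _ _ ?f |- context [cod ?f] => rewrite (hom_cod h)
  | h : comonoid ?D |- context [dom (eps ?D)] => rewrite (hom_dom (eps_hom h))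
  | h : comonoid ?D |- context [cod (eps ?D)] => rewrite (hom_cod (eps_hom h))
  | h : comonoid ?D |- context [dom (delta ?D)] => rewrite (hom_dom (delta_hom h))
  | h : comonoid ?D |- context [cod (delta ?D)] => rewrite (hom_cod (delta_hom h))
  | h : comonoid_morphism _ _ ?f |- context [dom ?f] =>
      rewrite (hom_dom (comonoid_morphism_hom h))
  | h : comonoid_morphism _ _ ?f |- context [cod ?f] =>
      rewrite (hom_cod (comonoid_morphism_hom h))
  | h : magma_morphism _ _ ?f |- context [dom ?f] =>
      rewrite (hom_dom (magma_morphism_hom h))
  | h : magma_morphism _ _ ?f |- context [cod ?f] =>
      rewrite (hom_cod (magma_morphism_hom h))
  end.

(** Domains and codomains are computed structurally; strictness then decides equality of the
    resulting objects, by reassociating to the left and erasing units. *)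
Ltac typ ::=
  lazymatch goal with
  | |- hom _ _ _ => split; typ
  | |- _ => unfold pairing; simpl; repeat (typ_step; simpl);
            rewrite ?tensA ?tens1o ?tenso1; reflexivity
  end.

(* With these hints the closing switch // discharges composability conditions. *)
#[local] Hint Extern 0 (@eq (obj _) _ _) => solve [typ] : core.
#[local] Hint Extern 0 (hom _ _ _) => solve [typ] : core.

(** * Calculus in a strict symmetric monoidal category *)

Section Category.
Variable C : ssm_category.
Implicit Types (A B D : obj C) (f g h : arr C).

Lemma comp1l B f : cod f = B -> B ∘ f = f.
Proof. by move=> <-; apply: comp_idl. Qed.

Lemma comp1r A f : dom f = A -> f ∘ A = f.
Proof. by move=> <-; apply: comp_idr. Qed.

Lemma tens1_comp A g f : dom g = cod f -> A ⊗ (g ∘ f) = (A ⊗ g) ∘ (A ⊗ f).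
Proof. by move=> E; rewrite -tensm_comp // comp1l. Qed.

Lemma tens_comp1 A g f : dom g = cod f -> (g ∘ f) ⊗ A = (g ⊗ A) ∘ (f ⊗ A).
Proof. by move=> E; rewrite -tensm_comp // comp1l. Qed.

Lemma tensm_lr A B f g : dom f = A -> cod g = B -> f ⊗ g = (f ⊗ B) ∘ (A ⊗ g).
Proof. by move=> *; rewrite -tensm_comp // comp1l // comp1r. Qed.

Lemma tensm_rl A B f g : cod f = A -> dom g = B -> f ⊗ g = (A ⊗ g) ∘ (f ⊗ B).
Proof. by move=> *; rewrite -tensm_comp // comp1l // comp1r. Qed.

(** The factors of f ⊗ g = (f ⊗ K) ∘ (K ⊗ g) both lose their unit object by strictness. *)
Lemma tensm_through_unit f g : dom f = K -> cod g = K -> f ⊗ g = f ∘ g.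
Proof. by move=> *; rewrite (@tensm_lr K K) // tensma1 tensm1a. Qed.

Lemma tensm_through_unit' f g : dom f = K -> cod g = K -> g ⊗ f = f ∘ g.
Proof. by move=> *; rewrite (@tensm_rl K K) // tensma1 tensm1a. Qed.

Lemma interchange A A' B B' f g : hom A A' f -> hom B B' g ->
  (f ⊗ B') ∘ (A ⊗ g) = (A' ⊗ g) ∘ (f ⊗ B).
Proof. by move=> *; rewrite -!tensm_comp // !comp1l // !comp1r. Qed.

Lemma braidN A A' B B' f g : hom A A' f -> hom B B' g ->
  braid A' B' ∘ (f ⊗ g) = (g ⊗ f) ∘ braid A B.
Proof. by move=> [<- <-] [<- <-]; rewrite braid_natural. Qed.

(** The hexagon at two copies of K makes this braid idempotent, and an invertible idempotent is an
    identity. *)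
Lemma braidA1 A : braid A K = idm A.
Proof.
have := braid_hexagon A K K; rewrite tens1o tensm1a tensma1 => E.
have := congr1 (comp (braid K A)) E.
by rewrite compA // braidK tenso1 comp1l // => <-.
Qed.

Lemma braid1A A : braid K A = idm A.
Proof. by have := braidK A K; rewrite braidA1 tenso1 comp1r. Qed.

Lemma iso_cancel A B f g h : isomorphism A B f -> cod g = A -> cod h = A ->
  f ∘ g = f ∘ h -> g = h.
Proof.
move=> [hf [k [hk Ek _]]] hg hh E.
by rewrite -(comp1l hg) -(comp1l hh) -Ek -!compA // E.
Qed.

Lemma iso_cancelr A B f g h : isomorphism A B f -> dom g = B -> dom h = B ->
  g ∘ f = h ∘ f -> g = h.
Proof.
move=> [hf [k [hk _ Ek]]] hg hh E.
by rewrite -(comp1r hg) -(comp1r hh) -Ek !compA // E.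
Qed.

Lemma isomorphism_id A : isomorphism A A (idm A).
Proof. by split=> //; exists (idm A); rewrite comp1l. Qed.

Lemma isomorphism_tens A B A' B' f g :
  isomorphism A B f -> isomorphism A' B' g ->
  isomorphism (A ⊗ A') (B ⊗ B') (f ⊗ g).
Proof.
move=> [hf [f' [hf' E1 E2]]] [hg [g' [hg' E3 E4]]].
split=> //; exists (f' ⊗ g'); split=> //; rewrite -tensm_comp //.
  by rewrite E1 E3 tensm_id.
by rewrite E2 E4 tensm_id.
Qed.

Lemma monomorphism_retract A B i r : hom A B i -> hom B A r -> r ∘ i = idm A ->
  monomorphism A B i.
Proof.
move=> hi hr E; split=> // F u v hu hv Euv.
by rewrite -(@comp1l A u) // -(@comp1l A v) // -E -!compA // Euv.
Qed.

(** By [braid_hexagon] the right side is a left inverse of [braid D (A ⊗ B)]; so is the left side,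
    and that braid is invertible. *)
Lemma braid_hexagon' A B D :
  braid (A ⊗ B) D = (braid A D ⊗ B) ∘ (A ⊗ braid B D).
Proof.
have E : ((braid A D ⊗ B) ∘ (A ⊗ braid B D)) ∘ braid D (A ⊗ B) = idm (D ⊗ (A ⊗ B)).
  rewrite braid_hexagon -compA // (@compA _ (A ⊗ braid B D)) //.
  rewrite -tensm_comp // braidK comp1l // tensm_id comp1l //.
  by rewrite -tensm_comp // braidK comp1l // tensm_id tensA.
apply: (@iso_cancelr (D ⊗ (A ⊗ B)) (A ⊗ B ⊗ D) (braid D (A ⊗ B))) => //.
  by split=> //; exists (braid (A ⊗ B) D); split=> //; rewrite braidK.
by rewrite E braidK.
Qed.

End Category.

(** * Comonoids and their tensor products *)

Section Comonoids.
Variable C : ssm_category.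
Implicit Types (D E F : comonoid_data C) (f g h : arr C).

Lemma comp_pairing D f g f' g' : comonoid D ->
  dom f' = cod f -> dom g' = cod g -> dom f = D -> dom g = D ->
  (f' ⊗ g') ∘ pairing D f g = pairing D (f' ∘ f) (g' ∘ g).
Proof. by move=> hD *; rewrite /pairing compA // -tensm_comp. Qed.

Lemma pairing_comp D E f g u : comonoid D -> comonoid E ->
  comonoid_morphism E D u -> dom f = D -> dom g = D ->
  pairing D f g ∘ u = pairing E (f ∘ u) (g ∘ u).
Proof.
move=> hD hE hu *.
by rewrite /pairing -compA // (comonoid_morphism_delta hu) compA // -tensm_comp.
Qed.

Lemma pairingA D f g h : comonoid D -> dom f = D -> dom g = D -> dom h = D ->
  pairing D (pairing D f g) h = pairing D f (pairing D g h).
Proof.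
move=> hD hf hg hh; rewrite /pairing.
have -> : ((f ⊗ g) ∘ delta D) ⊗ h = ((f ⊗ g) ⊗ h) ∘ (delta D ⊗ D).
  by rewrite -tensm_comp // comp1r.
have -> : f ⊗ ((g ⊗ h) ∘ delta D) = (f ⊗ (g ⊗ h)) ∘ (D ⊗ delta D).
  by rewrite -tensm_comp // comp1r.
by rewrite -!compA // (delta_coassoc hD) tensmA.
Qed.

Lemma pairing_eps_l D f : comonoid D -> dom f = D -> pairing D (eps D) f = f.
Proof.
move=> hD hf; rewrite /pairing.
have -> : eps D ⊗ f = (K ⊗ f) ∘ (eps D ⊗ D) by rewrite -tensm_comp // comp1l // comp1r.
by rewrite -compA // (delta_eps_l hD) tensm1a comp1r.
Qed.

Lemma pairing_eps_r D f : comonoid D -> dom f = D -> pairing D f (eps D) = f.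
Proof.
move=> hD hf; rewrite /pairing.
have -> : f ⊗ eps D = (f ⊗ K) ∘ (D ⊗ eps D) by rewrite -tensm_comp // comp1l // comp1r.
by rewrite -compA // (delta_eps_r hD) tensma1 comp1r.
Qed.

(** Naturality moves the braid of the inner factors past [f'] and [g]. Through this formula
    identities about a tensor product of comonoids reduce to its two factors. *)
Lemma pairing_tens D E (P P' Q Q' : obj C) f f' g g' : comonoid D -> comonoid E ->
  hom D P f -> hom E P' f' -> hom D Q g -> hom E Q' g' ->
  pairing (tens_comonoid D E) (f ⊗ f') (g ⊗ g') =
  (P ⊗ braid Q P' ⊗ Q') ∘ (pairing D f g ⊗ pairing E f' g').
Proof.
move=> hD hE hf hf' hg hg'; rewrite /pairing /=.
rewrite tensm_comp // !compA //; congr (_ ∘ _).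
rewrite !tensmA -(tensmA _ f' g) -(tensmA _ g f') -!tensm_comp //.
by rewrite (braidN hg hf') !comp1l // !comp1r.
Qed.

Lemma tens_comonoidP D E : comonoid D -> comonoid E ->
  comonoid (tens_comonoid D E).
Proof.
move=> hD hE; split=> //=.
- rewrite -/(delta (tens_comonoid D E)) -tensm_id.
  rewrite -/(pairing (tens_comonoid D E) (eps D ⊗ eps E) (D ⊗ E)).
  rewrite (@pairing_tens _ _ K K D E) // !pairing_eps_l // braidA1.
  by rewrite tensm1a !tensm_id comp1l.
- rewrite -/(delta (tens_comonoid D E)) -tensm_id.
  rewrite -/(pairing (tens_comonoid D E) (D ⊗ E) (eps D ⊗ eps E)).
  rewrite (@pairing_tens _ _ D E K K) // !pairing_eps_r // braid1A.
  by rewrite tensma1 !tensm_id comp1l.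
rewrite tens1_comp // tens_comp1 // -tensm_id.
rewrite -![in LHS]compA // -![in RHS]compA //.
rewrite -/(delta (tens_comonoid D E)).
(* Both sides of coassociativity are pairings on D ⊗ E of an identity with a coproduct, in the two
   orders. *)
have := @pairing_tens D E (D ⊗ D) (E ⊗ E) D E (delta D) (delta E) D E hD hE.
rewrite /pairing => -> //.
have := @pairing_tens D E D E (D ⊗ D) (E ⊗ E) D E (delta D) (delta E) hD hE.
rewrite /pairing => -> //.
rewrite (delta_coassoc hD) (delta_coassoc hE) ![in LHS]compA // ![in RHS]compA //.
congr (_ ∘ _).
(* Only braids remain. Both hexagons expand them into elementary braids, two of which act on
   disjoint factors and commute. *)
rewrite braid_hexagon braid_hexagon'.
rewrite !tens1_comp // !tens_comp1 // -!tensm_id !tensmA !compA //; congr (_ ∘ _).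
have := @interchange C (D ⊗ D ⊗ E) (D ⊗ E ⊗ D) (D ⊗ E ⊗ E) (E ⊗ D ⊗ E)
  (D ⊗ braid D E) (braid D E ⊗ E).
by rewrite -!tensm_id !tensmA; apply.
Qed.

(* Strictness makes this an equality of the data, carriers included. *)
Lemma tens_comonoidA D E F : comonoid D -> comonoid E -> comonoid F ->
  tens_comonoid D (tens_comonoid E F) = tens_comonoid (tens_comonoid D E) F.
Proof.
move=> hD hE hF; rewrite /tens_comonoid /=; congr ComonoidData; rewrite ?tensA ?tensmA //.
rewrite braid_hexagon braid_hexagon'.
rewrite -[delta D in LHS](@comp1l _ (D ⊗ D)) // -[delta F in RHS](@comp1l _ (F ⊗ F)) //.
rewrite !tensm_comp // !tens1_comp // !tens_comp1 // -!tensm_id !tensmA !compA //.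
congr (_ ∘ _); rewrite -!compA //; congr (_ ∘ _).
have := @interchange C (D ⊗ D ⊗ E) (D ⊗ E ⊗ D) (E ⊗ F ⊗ F) (F ⊗ E ⊗ F)
  (D ⊗ braid D E) (braid E F ⊗ F).
by rewrite -!tensm_id !tensmA; apply.
Qed.

Lemma comonoid_morphism_id D : comonoid D -> comonoid_morphism D D (idm D).
Proof. by move=> hD; split=> //; rewrite ?tensm_id ?comp1l // comp1r. Qed.

Lemma comonoid_morphism_comp D E F f g : comonoid D -> comonoid E -> comonoid F ->
  comonoid_morphism E F g -> comonoid_morphism D E f ->
  comonoid_morphism D F (g ∘ f).
Proof.
move=> hD hE hF hg hf; split=> //.
  by rewrite compA // (comonoid_morphism_eps hg) (comonoid_morphism_eps hf).
rewrite compA // (comonoid_morphism_delta hg) -compA //.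
by rewrite (comonoid_morphism_delta hf) compA // -tensm_comp.
Qed.

Lemma comonoid_morphism_tens D D' E E' f g :
  comonoid D -> comonoid D' -> comonoid E -> comonoid E' ->
  comonoid_morphism D D' f -> comonoid_morphism E E' g ->
  comonoid_morphism (tens_comonoid D E) (tens_comonoid D' E') (f ⊗ g).
Proof.
move=> hD hD' hE hE' hf hg; split=> //=.
  by rewrite -tensm_comp // (comonoid_morphism_eps hf) (comonoid_morphism_eps hg).
rewrite -compA // -tensm_comp // (comonoid_morphism_delta hf).
rewrite (comonoid_morphism_delta hg).
rewrite -/(delta (tens_comonoid D E)) -/(pairing (tens_comonoid D E) (f ⊗ g) (f ⊗ g)).
by rewrite (@pairing_tens _ _ D' E' D' E').
Qed.

Definition unit_comonoid : comonoid_data C := ComonoidData K (idm K) (idm K).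

Lemma unit_comonoidP : comonoid unit_comonoid.
Proof. by split=> //=; rewrite ?tensm_id ?tens1o comp1l. Qed.

Lemma tens_comonoid1o D : comonoid D -> tens_comonoid unit_comonoid D = D.
Proof.
case: D => D e d [/= he hd _ _ _]; rewrite /tens_comonoid /=.
by rewrite tens1o braid1A !tensm1a tensm_id comp1l.
Qed.

Lemma tens_comonoido1 D : comonoid D -> tens_comonoid D unit_comonoid = D.
Proof.
case: D => D e d [/= he hd _ _ _]; rewrite /tens_comonoid /=.
by rewrite tenso1 braidA1 !tensma1 tensm_id comp1l.
Qed.

Lemma comonoid_morphism_eps_unit D : comonoid D ->
  comonoid_morphism D unit_comonoid (eps D).
Proof.
move=> hD; split=> //=; rewrite comp1l //.
by rewrite -/(pairing D (eps D) (eps D)) pairing_eps_l.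
Qed.

(** The braid in the middle is that of K with K, hence trivial, and the counits absorb the
    coproducts. Composing with a comonoid morphism then recovers it from its two components. *)
Lemma pairing_proj D E : comonoid D -> comonoid E ->
  pairing (tens_comonoid D E) (D ⊗ eps E) (eps D ⊗ E) = idm (D ⊗ E).
Proof.
move=> hD hE; rewrite (@pairing_tens _ _ D K K E) // pairing_eps_l // pairing_eps_r //.
by rewrite braidA1 tensma1 !tensm_id comp1l.
Qed.

Lemma pairing_proj_swap D E : comonoid D -> comonoid E ->
  pairing (tens_comonoid D E) (eps D ⊗ E) (D ⊗ eps E) = braid D E.
Proof.
move=> hD hE; rewrite (@pairing_tens _ _ K E D K) // pairing_eps_l // pairing_eps_r //.
by rewrite tensma1 tensm1a tensm_id comp1r.
Qed.

Lemma comonoid_morphism_pairing F D E f :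
  comonoid F -> comonoid D -> comonoid E ->
  comonoid_morphism F (tens_comonoid D E) f ->
  f = pairing F ((D ⊗ eps E) ∘ f) ((eps D ⊗ E) ∘ f).
Proof.
move=> hF hD hE hf; have hDE := tens_comonoidP hD hE.
by rewrite -(pairing_comp hDE) // pairing_proj // comp1l.
Qed.

Lemma comonoid_morphism_pairing_swap F D E f :
  comonoid F -> comonoid D -> comonoid E ->
  comonoid_morphism F (tens_comonoid D E) f ->
  braid D E ∘ f = pairing F ((eps D ⊗ E) ∘ f) ((D ⊗ eps E) ∘ f).
Proof.
move=> hF hD hE hf; have hDE := tens_comonoidP hD hE.
by rewrite -(pairing_comp hDE) // pairing_proj_swap.
Qed.

Lemma eq_comonoid_morphism F D E f g :
  comonoid F -> comonoid D -> comonoid E ->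
  comonoid_morphism F (tens_comonoid D E) f ->
  comonoid_morphism F (tens_comonoid D E) g ->
  (D ⊗ eps E) ∘ f = (D ⊗ eps E) ∘ g -> (eps D ⊗ E) ∘ f = (eps D ⊗ E) ∘ g ->
  f = g.
Proof.
move=> hF hD hE hf hg E1 E2.
by rewrite (comonoid_morphism_pairing hF hD hE hf) E1 E2 -comonoid_morphism_pairing.
Qed.

Lemma comonoid_morphism_inv D E f g : comonoid D -> comonoid E ->
  comonoid_morphism D E f -> hom E D g -> f ∘ g = idm E -> g ∘ f = idm D ->
  comonoid_morphism E D g.
Proof.
move=> hD hE hf hg E1 E2; split=> //.
  by rewrite -(comonoid_morphism_eps hf) -compA // E1 comp1r.
rewrite -[delta D](@comp1l _ (D ⊗ D)) // -tensm_id -E2 tensm_comp //.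
rewrite -(compA (f := delta D)) // -(comonoid_morphism_delta hf).
by rewrite -!compA // E1 comp1r.
Qed.

Section PairingMorphism.
Variables (F D E : comonoid_data C) (f g : arr C).
Hypotheses (hF : comonoid F) (hD : comonoid D) (hE : comonoid E).
Hypotheses (hf : comonoid_morphism F D f) (hg : comonoid_morphism F E g).

Lemma proj_pairing_l : (D ⊗ eps E) ∘ pairing F f g = f.
Proof. by rewrite comp_pairing // comp1l // (comonoid_morphism_eps hg) pairing_eps_r. Qed.

Lemma proj_pairing_r : (eps D ⊗ E) ∘ pairing F f g = g.
Proof. by rewrite comp_pairing // comp1l // (comonoid_morphism_eps hf) pairing_eps_l. Qed.

(* In f z1 ⊗ f z2 ⊗ g z3 ⊗ g z4 the hypothesis rewrites the braiding of the two
   inner factors as g z2 ⊗ f z3. *)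
Lemma pairing_morphism : pairing F g f = braid D E ∘ pairing F f g ->
  comonoid_morphism F (tens_comonoid D E) (pairing F f g).
Proof.
move=> Ec; split=> //=.
  rewrite comp_pairing // (comonoid_morphism_eps hf) (comonoid_morphism_eps hg).
  by rewrite pairing_eps_l.
rewrite -[LHS]compA // comp_pairing // (comonoid_morphism_delta hf).
rewrite (comonoid_morphism_delta hg) -!/(pairing F _ _).
rewrite pairingA // -(pairingA hF (f := f) (g := g)) // -tensmA.
rewrite comp_pairing // comp_pairing // -Ec !comp1l //.
by rewrite pairingA // -pairingA.
Qed.

End PairingMorphism.

End Comonoids.

(** * Hopf quasigroups *)

Section HopfMorphisms.
Variable C : ssm_category.
Implicit Types (B D E : hopf_data C) (u v f g : arr C).

(** The typing and comonoid assumptions are separate because the double cross product enters only as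
    [hopf_data], with no Hopf quasigroup axioms at hand. *)
Lemma hopf_morphism_comp B D E u v :
  hom K B (eta B) -> hom (B ⊗ B) B (mu B) ->
  hom (D ⊗ D) D (mu D) -> hom (E ⊗ E) E (mu E) ->
  comonoid B -> comonoid D -> comonoid E ->
  hopf_morphism D E u -> hopf_morphism B D v -> hopf_morphism B E (u ∘ v).
Proof.
move=> hom_etaB hom_muB hom_muD hom_muE hB hD hE [hu hu'] [hv hv']; split; last first.
  exact: comonoid_morphism_comp hu' hv'.
split=> //.
  by rewrite -compA // (magma_morphism_eta hv) (magma_morphism_eta hu).
rewrite -compA // (magma_morphism_mu hv) compA // (magma_morphism_mu hu) -compA //.
by rewrite -tensm_comp.
Qed.

Lemma hopf_morphism_inv B D f g :
  hom K B (eta B) -> hom (B ⊗ B) B (mu B) -> hom (D ⊗ D) D (mu D) ->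
  comonoid B -> comonoid D -> hopf_morphism B D f ->
  hom D B g -> g ∘ f = idm B -> f ∘ g = idm D -> hopf_morphism D B g.
Proof.
move=> hom_eta hom_muB hom_muD hB hD [hf hf'] hg E1 E2.
split; last exact: comonoid_morphism_inv hf' hg E2 E1.
split=> //; first by rewrite -(magma_morphism_eta hf) compA // E1 comp1l.
have E : mu D = f ∘ mu B ∘ (g ⊗ g).
  by rewrite (magma_morphism_mu hf) -compA // -tensm_comp // E2 tensm_id comp1r.
by rewrite E !compA // E1 comp1l.
Qed.

End HopfMorphisms.

Section HopfQuasigroup.
Variables (C : ssm_category) (H : hopf_quasigroup C).
Implicit Types (f g : arr C).

Lemma hopf_comonoidP : comonoid H.
Proof. exact: hq_comonoid (hopf_quasigroupP H). Qed.

Let hH := hopf_comonoidP.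

Lemma mul_eta_l f : cod f = H -> mu H ∘ (eta H ⊗ f) = f.
Proof.
move=> E; rewrite (@tensm_lr _ K H) // tensm1a compA //.
by rewrite (mu_eta_l (hq_unital_magma (hopf_quasigroupP H))) comp1l.
Qed.

Lemma mul_eta_r f : cod f = H -> mu H ∘ (f ⊗ eta H) = f.
Proof.
move=> E; rewrite (@tensm_rl _ H K) // tensma1 compA //.
by rewrite (mu_eta_r (hq_unital_magma (hopf_quasigroupP H))) comp1l.
Qed.

Lemma mu_comonoid_morphism : comonoid_morphism (tens_comonoid H H) H (mu H).
Proof.
split=> //=.
  rewrite (magma_morphism_mu (hq_eps_magma (hopf_quasigroupP H))) /=.
  by rewrite comp1l.
by rewrite (magma_morphism_mu (hq_delta_magma (hopf_quasigroupP H))) /= -compA.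
Qed.

Lemma eta_comonoid_morphism : comonoid_morphism (unit_comonoid C) H (eta H).
Proof.
split=> //=.
  exact: (magma_morphism_eta (hq_eps_magma (hopf_quasigroupP H))).
rewrite comp1r //.
exact: (magma_morphism_eta (hq_delta_magma (hopf_quasigroupP H))).
Qed.

Lemma eps_eta : eps H ∘ eta H = idm K.
Proof. exact: (comonoid_morphism_eps eta_comonoid_morphism). Qed.

(** The law (x h1) λ(h2) = x ε(h) at x = 1. *)
Lemma mul_lam : mu H ∘ pairing H H (lam H) = eta H ∘ eps H.
Proof.
have := congr1 (fun f => f ∘ (eta H ⊗ H)) (lam_r' (hopf_quasigroupP H)).
rewrite -!compA // -(@interchange _ K H H (H ⊗ H)) // tensm1a.
rewrite -tensm_id tensmA (compA (f := delta H)) // -[_ ⊗ _ ∘ _ ⊗ _]tensm_comp //.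
rewrite mul_eta_l // comp1r // => ->.
by rewrite -tensm_comp // comp1l // comp1r // tensm_through_unit.
Qed.

(* lam X (f h) = lam X (f h1) * (f h2 * f (lam h3)) = f (lam h). *)
Lemma antipode_morphism (X : hopf_quasigroup C) f :
  hopf_morphism H X f -> f ∘ lam H = lam X ∘ f.
Proof.
case=> hf hf'; have hX := hq_comonoid (hopf_quasigroupP X).
have := congr1 (fun p => p ∘ pairing H f (f ∘ lam H)) (lam_l (hopf_quasigroupP X)).
rewrite /= comp_pairing // (comonoid_morphism_eps hf') comp1l // pairing_eps_l // => <-.
rewrite -!compA // comp_pairing // (comonoid_morphism_delta hf') comp1l //.
rewrite -/(pairing H f f) pairingA // comp_pairing //.
have -> : mu X ∘ pairing H f (f ∘ lam H) = eta X ∘ eps H.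
  rewrite -[f in pairing H f _](@comp1r _ H) // -comp_pairing // compA //.
  rewrite -(magma_morphism_mu hf) -compA // mul_lam compA //.
  by rewrite (magma_morphism_eta hf).
rewrite -[lam X ∘ f in LHS](@comp1l _ X) // -comp_pairing // pairing_eps_r //.
rewrite compA // (mu_eta_r (hq_unital_magma (hopf_quasigroupP X))).
by rewrite comp1l.
Qed.

Section AntipodeCancellation.
Variables (X : hopf_quasigroup C) (i r : arr C) (D : obj C).
Hypotheses (hi : hopf_morphism H X i) (hr : hom D X r).

Local Notation "p • q" := (mu X ∘ (p ⊗ q)) (at level 42, left associativity).

Let i_comonoid : comonoid_morphism H X i := proj2 hi.

Let iδr : (i ⊗ i ⊗ r) ∘ (delta H ⊗ D) = (delta X ⊗ X) ∘ (i ⊗ r).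
Proof.
rewrite -!tensm_comp // (comonoid_morphism_delta i_comonoid).
by rewrite comp1l // comp1r.
Qed.

Let riδ : (r ⊗ i ⊗ i) ∘ (D ⊗ delta H) = (X ⊗ delta X) ∘ (r ⊗ i).
Proof.
rewrite -tensmA -!tensm_comp // (comonoid_morphism_delta i_comonoid).
by rewrite comp1l // comp1r.
Qed.

(** In elements, i(λ(h1)) (i(h2) r) = ε(h) r. Since i commutes with antipodes and coproducts, this
    is the antipode law of X at i(h); the next three lemmas transport the other three laws in the
    same way. *)
Lemma mul_lam_l : ((i ∘ lam H) • (i • r)) ∘ (delta H ⊗ D) = eps H ⊗ r.
Proof.
rewrite (antipode_morphism hi) (tensm_comp (f := i) (g := lam X)) // tensmA.
rewrite -!compA // iδr !compA // (lam_l (hopf_quasigroupP X)) -tensm_comp //.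
by rewrite (comonoid_morphism_eps i_comonoid) comp1l.
Qed.

Lemma mul_lam_l' : (i • ((i ∘ lam H) • r)) ∘ (delta H ⊗ D) = eps H ⊗ r.
Proof.
rewrite (antipode_morphism hi).
have -> : i ⊗ ((lam X ∘ i) • r) = (X ⊗ mu X) ∘ (X ⊗ lam X ⊗ X) ∘ (i ⊗ i ⊗ r).
  by rewrite -!tensmA -!compA // -!tensm_comp // !comp1l.
rewrite -!compA // iδr !compA // (lam_l' (hopf_quasigroupP X)) -tensm_comp //.
by rewrite (comonoid_morphism_eps i_comonoid) comp1l.
Qed.

Lemma mul_lam_r : ((r • (i ∘ lam H)) • i) ∘ (D ⊗ delta H) = r ⊗ eps H.
Proof.
rewrite (antipode_morphism hi).
have -> : (r • (lam X ∘ i)) ⊗ i = (mu X ⊗ X) ∘ (X ⊗ lam X ⊗ X) ∘ (r ⊗ i ⊗ i).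
  by rewrite -!compA // -!tensm_comp // !comp1l.
rewrite -!compA // riδ !compA // (lam_r (hopf_quasigroupP X)) -tensm_comp //.
by rewrite (comonoid_morphism_eps i_comonoid) comp1l.
Qed.

Lemma mul_lam_r' : ((r • i) • (i ∘ lam H)) ∘ (D ⊗ delta H) = r ⊗ eps H.
Proof.
rewrite (antipode_morphism hi) (tensm_comp (f := r ⊗ i) (g := mu X)) //.
rewrite -!compA // riδ !compA // (lam_r' (hopf_quasigroupP X)) -tensm_comp //.
by rewrite (comonoid_morphism_eps i_comonoid) comp1l.
Qed.

End AntipodeCancellation.

End HopfQuasigroup.

Section Products.
Variables (C : ssm_category) (X : hopf_quasigroup C).
Implicit Types (p q u v : arr C).

Local Notation "p • q" := (mu X ∘ (p ⊗ q)) (at level 42, left associativity).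

Lemma prod_comp p q u v : cod p = X -> cod q = X ->
  dom p = cod u -> dom q = cod v ->
  (p • q) ∘ (u ⊗ v) = (p ∘ u) • (q ∘ v).
Proof. by move=> *; rewrite -compA // -tensm_comp. Qed.

Lemma prod_compl p q u D : cod p = X -> cod q = X ->
  dom p = cod u -> dom q = D -> (p • q) ∘ (u ⊗ D) = (p ∘ u) • q.
Proof. by move=> *; rewrite prod_comp // comp1r. Qed.

Lemma prod_compr p q v D : cod p = X -> cod q = X ->
  dom p = D -> dom q = cod v -> (p • q) ∘ (D ⊗ v) = p • (q ∘ v).
Proof. by move=> *; rewrite prod_comp // comp1r. Qed.

End Products.

(** Beck's axioms for a distributive law, asked of unital magmas in place of monoids and of a
    morphism of comonoids. *)
Record distributive_law (C : ssm_category) (A H : hopf_quasigroup C) (psi : arr C)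
    : Prop := DistributiveLaw {
  dl_comonoid : comonoid_morphism (tens_comonoid H A) (tens_comonoid A H) psi;
  dl_eta_H : psi ∘ (eta H ⊗ A) = A ⊗ eta H;
  dl_eta_A : psi ∘ (H ⊗ eta A) = eta A ⊗ H;
  dl_mu_H : psi ∘ (mu H ⊗ A) = (A ⊗ mu H) ∘ (psi ⊗ H) ∘ (H ⊗ psi);
  dl_mu_A : psi ∘ (H ⊗ mu A) = (mu A ⊗ H) ∘ (A ⊗ psi) ∘ (psi ⊗ A)
}.

(** * From a factorization to a matched pair *)

Section FactorizationLaw.
Variables (C : ssm_category) (X A H : hopf_quasigroup C) (iA iH : arr C).
Hypotheses (lamH : isomorphism H H (lam H)) (lamA : isomorphism A A (lam A)).
Hypothesis fXAH : factorization X A H iA iH.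

Let hA : comonoid A := hopf_comonoidP A.
Let hH : comonoid H := hopf_comonoidP H.
Let hX : comonoid X := hopf_comonoidP X.
Let iA_magma : magma_morphism A X iA := proj1 (iA_morphism fXAH).
Let iH_magma : magma_morphism H X iH := proj1 (iH_morphism fXAH).
Let iA_comonoid : comonoid_morphism A X iA := proj2 (iA_morphism fXAH).
Let iH_comonoid : comonoid_morphism H X iH := proj2 (iH_morphism fXAH).

Local Notation "p • q" := (mu X ∘ (p ⊗ q)) (at level 42, left associativity).
Local Notation om := (omega X iA iH).

Let hom_om : hom (A ⊗ H) X om.
Proof. by case: (omega_iso fXAH). Qed.

(** The factorization condition at a generalized element [r] of X, obtained by precomposition;
    [prodA_XAH] does the same on the other side. *)
Lemma prodA_AH r : cod r = X -> om • r = iA • (iH • r).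
Proof.
move=> hr; transitivity ((om • X) ∘ ((A ⊗ H)%ob ⊗ r)).
  by rewrite prod_comp // comp1l // comp1r.
rewrite (omega_mul_l fXAH) -tensm_id -tensmA !prod_comp //.
by rewrite comp1l // !comp1r.
Qed.

Lemma prodA_XAH r : cod r = X -> r • om = (r • iA) • iH.
Proof.
move=> hr; transitivity ((X • om) ∘ (r ⊗ (A ⊗ H)%ob)).
  by rewrite prod_comp // comp1l // comp1r.
rewrite (omega_mul_r fXAH) -tensm_id tensmA !prod_comp //.
by rewrite comp1l // !comp1r.
Qed.

Let lamHA := isomorphism_tens lamH lamA.

(** The condition on θ is given only after λ_H ⊗ λ_A. Invertibility of both antipodes removes this
    twist, here and in [prodA_XHA]. *)
Lemma prodA_HA r : cod r = X -> (iH • iA) • r = iH • (iA • r).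
Proof.
move=> hr.
have E : (iH • iA) • X = iH • (iA • X).
  apply: (iso_cancelr (isomorphism_tens lamHA (isomorphism_id X))) => //.
  have := theta_mul_l fXAH; rewrite /theta => E.
  rewrite prod_comp // comp1l // E -tensmA !prod_comp //.
  by rewrite comp1l.
transitivity ((iH • iA) • X ∘ ((H ⊗ A)%ob ⊗ r)).
  by rewrite prod_comp // comp1l // comp1r.
by rewrite E -tensm_id -tensmA !prod_comp // comp1l // !comp1r.
Qed.

Lemma prodA_XHA r : cod r = X -> r • (iH • iA) = (r • iH) • iA.
Proof.
move=> hr.
have E : X • (iH • iA) = (X • iH) • iA.
  apply: (iso_cancelr (isomorphism_tens (isomorphism_id X) lamHA)) => //.
  have := theta_mul_r fXAH; rewrite /theta => E.
  by rewrite prod_comp // comp1l // E tensmA !prod_comp // comp1l.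
transitivity (X • (iH • iA) ∘ (r ⊗ (H ⊗ A)%ob)).
  by rewrite prod_comp // comp1l // comp1r.
by rewrite E -tensm_id tensmA !prod_comp // comp1l // !comp1r.
Qed.

Let om_cancel p q : cod p = (A ⊗ H)%ob -> cod q = (A ⊗ H)%ob ->
  om ∘ p = om ∘ q -> p = q.
Proof. exact: iso_cancel (omega_iso fXAH). Qed.

Lemma omega_comonoid : comonoid_morphism (tens_comonoid A H) X om.
Proof.
have hAH := tens_comonoidP hA hH; have hXX := tens_comonoidP hX hX.
apply: (@comonoid_morphism_comp _ _ (tens_comonoid X X)) => //.
  exact: mu_comonoid_morphism.
exact: comonoid_morphism_tens.
Qed.

Lemma theta_comonoid : comonoid_morphism (tens_comonoid H A) X (iH • iA).
Proof.
have hHA := tens_comonoidP hH hA; have hXX := tens_comonoidP hX hX.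
apply: (@comonoid_morphism_comp _ _ (tens_comonoid X X)) => //.
  exact: mu_comonoid_morphism.
exact: comonoid_morphism_tens.
Qed.

Variable psi : arr C.
Hypothesis psi_comonoid : comonoid_morphism (tens_comonoid H A) (tens_comonoid A H) psi.
Hypothesis om_psi : om ∘ psi = iH • iA.

(** Left multiplication by H, read on A ⊗ H through ω: h(ak) = (ha)k, then ψ rewrites ha as a'h',
    and (a'h')k = a'(h'k). *)
Lemma prod_iH_om : iH • om = om ∘ ((A ⊗ mu H) ∘ (psi ⊗ H)).
Proof.
rewrite prodA_XAH // -om_psi.
rewrite -(@prod_compl _ _ _ _ _ H) //.
by rewrite prodA_AH // -(magma_morphism_mu iH_magma) compA // /omega prod_compr.
Qed.

Lemma prod_iA_om : iA • om = om ∘ (mu A ⊗ H).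
Proof.
by rewrite prodA_XAH // -(magma_morphism_mu iA_magma) /omega prod_compl.
Qed.

(** Right multiplication by A, read on A ⊗ H through ω: (ah)b = a(hb), ψ rewrites hb as b'h', and
    a(b'h') = (ab')h'. *)
Lemma prod_om_iA : om • iA = om ∘ ((mu A ⊗ H) ∘ (A ⊗ psi)).
Proof.
rewrite prodA_AH // -om_psi.
rewrite -(@prod_compr _ _ _ _ _ A) //.
by rewrite prod_iA_om compA.
Qed.

(** Every equation is tested after the isomorphism ω, under which ψ becomes the product of H and A
    inside X. *)
Lemma factorization_law : distributive_law A H psi.
Proof.
split=> //.
- apply: om_cancel => //.
  rewrite compA // om_psi !prod_comp // (magma_morphism_eta iH_magma) !comp1r //.
  by rewrite mul_eta_l // mul_eta_r.
- apply: om_cancel => //.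
  rewrite compA // om_psi !prod_comp // (magma_morphism_eta iA_magma) !comp1r //.
  by rewrite mul_eta_l // mul_eta_r.
- apply: om_cancel => //.
  rewrite compA // om_psi prod_comp // (magma_morphism_mu iH_magma) comp1r //.
  (* Here (hk)a = h(ka), and ka = ω(ψ(k ⊗ a)) is then multiplied by h on the left. *)
  rewrite -prodA_XHA // -om_psi -(@prod_compr _ _ _ _ _ H) //.
  by rewrite prod_iH_om -compA.
apply: om_cancel => //.
rewrite compA // om_psi prod_comp // (magma_morphism_mu iA_magma) comp1r //.
(* Symmetrically h(ab) = (ha)b, with ha rewritten by ψ and multiplied by b on the right. *)
rewrite -prodA_HA // -om_psi -(@prod_compl _ _ _ _ _ A) //.
by rewrite prod_om_iA -compA.
Qed.

(** Two successive left multiplications by H, so under ω this is λ(h1)(h2 x) = ε(h) x in X at x = ω.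
    The next three lemmas are h1(λ(h2) x) = ε(h) x, (x a1) λ(a2) = x ε(a) and (x λ(a1)) a2 = x
    ε(a). *)
Lemma factorization_lam_H_l :
  (A ⊗ mu H) ∘ (psi ⊗ H) ∘ (lam H ⊗ ((A ⊗ mu H) ∘ (psi ⊗ H))) ∘ (delta H ⊗ A ⊗ H) =
  eps H ⊗ A ⊗ H.
Proof.
apply: om_cancel => //.
rewrite !compA // -(compA (g := A ⊗ mu H)) // -prod_iH_om.
rewrite prod_comp // -prod_iH_om -tensmA tensm_id.
rewrite (mul_lam_l (iH_morphism fXAH)) //.
by rewrite -tensmA tensm_id (@tensm_rl _ K (A ⊗ H)) // tensm1a.
Qed.

Lemma factorization_lam_H_r :
  (A ⊗ mu H) ∘ (psi ⊗ H) ∘ (H ⊗ ((A ⊗ mu H) ∘ (psi ⊗ H))) ∘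
    (((H ⊗ lam H) ∘ delta H) ⊗ A ⊗ H) =
  eps H ⊗ A ⊗ H.
Proof.
apply: om_cancel => //.
rewrite !compA // -(compA (g := A ⊗ mu H)) // -prod_iH_om.
rewrite prod_compr // -prod_iH_om -tensmA tensm_id tens_comp1 // compA //.
rewrite -tensmA prod_compr // (@prod_compl _ X iH om (lam H)) //.
rewrite (mul_lam_l' (iH_morphism fXAH)) //.
by rewrite -tensmA tensm_id (@tensm_rl _ K (A ⊗ H)) // tensm1a.
Qed.

Lemma factorization_lam_A_r :
  (mu A ⊗ H) ∘ (A ⊗ psi) ∘ (((mu A ⊗ H) ∘ (A ⊗ psi)) ⊗ lam A) ∘ (A ⊗ H ⊗ delta A) =
  A ⊗ H ⊗ eps A.
Proof.
apply: om_cancel => //.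
rewrite !compA // -(compA (g := mu A ⊗ H)) // -prod_om_iA.
rewrite prod_comp // -prod_om_iA tensm_id.
rewrite (mul_lam_r' (iA_morphism fXAH)) //.
by rewrite (@tensm_lr _ (A ⊗ H) K) // tensma1.
Qed.

Lemma factorization_lam_A_l :
  (mu A ⊗ H) ∘ (A ⊗ psi) ∘ (((mu A ⊗ H) ∘ (A ⊗ psi)) ⊗ A) ∘
    (A ⊗ H ⊗ ((lam A ⊗ A) ∘ delta A)) =
  A ⊗ H ⊗ eps A.
Proof.
apply: om_cancel => //.
rewrite !compA // -(compA (g := mu A ⊗ H)) // -prod_om_iA.
rewrite prod_compl // -prod_om_iA tensm_id tens1_comp // compA //.
rewrite tensmA prod_compl // (@prod_compr _ X om iA (lam A)) //.
rewrite (mul_lam_r (iA_morphism fXAH)) //.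
by rewrite (@tensm_lr _ (A ⊗ H) K) // tensma1.
Qed.

Lemma omega_eta : om ∘ (eta A ⊗ eta H) = eta X.
Proof.
rewrite prod_comp // (magma_morphism_eta iA_magma) (magma_morphism_eta iH_magma).
by rewrite mul_eta_l.
Qed.

(** With y = bk, (ah)y = a(hy), and left multiplications by H and by A are both known through ω. *)
Lemma omega_mu : om ∘ ((mu A ⊗ mu H) ∘ (A ⊗ psi ⊗ H)) = om • om.
Proof.
rewrite prodA_AH // prod_iH_om -(@prod_compr _ _ _ _ _ A) // prod_iA_om -compA //.
congr (_ ∘ _); rewrite tens1_comp // compA // !tensmA; congr (_ ∘ _).
by rewrite (@tensm_lr _ (A ⊗ A) H) // tensm_id.
Qed.

End FactorizationLaw.

(** * Components of the two multiplicativity axioms *)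

Section Projections.
Variables (C : ssm_category) (A H : hopf_quasigroup C) (psi : arr C).
Hypothesis hom_psi : hom (H ⊗ A) (A ⊗ H) psi.

Local Notation phiA := ((A ⊗ eps H) ∘ psi).
Local Notation phiH := ((eps A ⊗ H) ∘ psi).

Lemma projA_mu_A :
  (A ⊗ eps H) ∘ ((mu A ⊗ H) ∘ (A ⊗ psi) ∘ (psi ⊗ A)) =
  mu A ∘ (A ⊗ phiA) ∘ (psi ⊗ A).
Proof.
rewrite tens1_comp // !compA //; congr (_ ∘ _ ∘ _).
by rewrite tensmA tensm_id -(@interchange _ (A ⊗ A) A H K) // tensma1.
Qed.

Lemma projH_mu_H :
  (eps A ⊗ H) ∘ ((A ⊗ mu H) ∘ (psi ⊗ H) ∘ (H ⊗ psi)) =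
  mu H ∘ (phiH ⊗ H) ∘ (H ⊗ psi).
Proof.
rewrite tens_comp1 // !compA //; congr (_ ∘ _ ∘ _).
by rewrite -tensmA tensm_id (@interchange _ A K (H ⊗ H) H) // tensm1a.
Qed.

(** Multiplicativity of the counit splits it over [mu H], so this component is an iterated action;
    the components that keep a product give the compatibility axioms. *)
Lemma projA_mu_H :
  (A ⊗ eps H) ∘ ((A ⊗ mu H) ∘ (psi ⊗ H) ∘ (H ⊗ psi)) = phiA ∘ (H ⊗ phiA).
Proof.
rewrite tens1_comp // !compA //; congr (_ ∘ _); symmetry.
rewrite tensmA tensm_id -[phiA in LHS]tensma1 (@interchange _ _ A H K) //.
rewrite tens_comp1 // compA //; congr (_ ∘ _); rewrite -!tensm_comp //.
rewrite (comonoid_morphism_eps (mu_comonoid_morphism H)) /=.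
by rewrite !comp1l // comp1r // tensmA.
Qed.

Lemma projH_mu_A :
  (eps A ⊗ H) ∘ ((mu A ⊗ H) ∘ (A ⊗ psi) ∘ (psi ⊗ A)) = phiH ∘ (phiH ⊗ A).
Proof.
rewrite tens_comp1 // !compA //; congr (_ ∘ _); symmetry.
rewrite -tensmA tensm_id -[phiH in LHS]tensm1a -(@interchange _ A K _ H) //.
rewrite tens1_comp // compA //; congr (_ ∘ _); rewrite -!tensm_comp //.
rewrite (comonoid_morphism_eps (mu_comonoid_morphism A)) /=.
by rewrite !comp1l // comp1r // tensmA.
Qed.

End Projections.

(** * The matched pair of a distributive law *)

Section LawMatchedPair.
Variables (C : ssm_category) (A H : hopf_quasigroup C) (psi : arr C).
Hypothesis law : distributive_law A H psi.

Let hA : comonoid A := hopf_comonoidP A.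
Let hH : comonoid H := hopf_comonoidP H.
Let hHA := tens_comonoidP hH hA.
Let hAH := tens_comonoidP hA hH.
Let psi_comonoid := dl_comonoid law.

Local Notation phiA := ((A ⊗ eps H) ∘ psi).
Local Notation phiH := ((eps A ⊗ H) ∘ psi).

Let phiA_comonoid : comonoid_morphism (tens_comonoid H A) A phiA.
Proof.
apply: comonoid_morphism_comp psi_comonoid => //.
(* The target A is read as A ⊗ K, which makes the projection a tensor product of an identity and a
   counit. *)
rewrite -[X in comonoid_morphism _ X](tens_comonoido1 hA).
apply: comonoid_morphism_tens => //; first exact: unit_comonoidP.
  exact: comonoid_morphism_id.
exact: comonoid_morphism_eps_unit.
Qed.

Let phiH_comonoid : comonoid_morphism (tens_comonoid H A) H phiH.
Proof.
apply: comonoid_morphism_comp psi_comonoid => //.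
rewrite -[X in comonoid_morphism _ X](tens_comonoid1o hH).
apply: comonoid_morphism_tens => //; first exact: unit_comonoidP.
  exact: comonoid_morphism_eps_unit.
exact: comonoid_morphism_id.
Qed.

Lemma law_Psi : Psi A H phiA phiH = psi.
Proof. exact: esym (comonoid_morphism_pairing hHA hA hH psi_comonoid). Qed.

Lemma law_phiA_mu : phiA ∘ (H ⊗ mu A) = mu A ∘ (A ⊗ phiA) ∘ (psi ⊗ A).
Proof. by rewrite -compA // (dl_mu_A law) projA_mu_A. Qed.

Lemma law_phiH_mu : phiH ∘ (mu H ⊗ A) = mu H ∘ (phiH ⊗ H) ∘ (H ⊗ psi).
Proof. by rewrite -compA // (dl_mu_H law) projH_mu_H. Qed.

Lemma law_phiA_act : phiA ∘ (H ⊗ phiA) = phiA ∘ (mu H ⊗ A).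
Proof. by rewrite -[RHS]compA // (dl_mu_H law) projA_mu_H. Qed.

Lemma law_phiH_act : phiH ∘ (phiH ⊗ A) = phiH ∘ (H ⊗ mu A).
Proof. by rewrite -[RHS]compA // (dl_mu_A law) projH_mu_A. Qed.

Lemma law_left_module : left_module_comonoid H A phiA.
Proof.
split=> //.
- rewrite -compA // (dl_eta_H law) -tensm_comp // eps_eta comp1l //.
  by rewrite tensma1.
- exact: law_phiA_act.
- exact: comonoid_morphism_eps phiA_comonoid.
exact: comonoid_morphism_delta phiA_comonoid.
Qed.

Lemma law_right_module : right_module_comonoid A H phiH.
Proof.
split=> //.
- rewrite -compA // (dl_eta_A law) -tensm_comp // eps_eta comp1l //.
  by rewrite tensm1a.
- exact: law_phiH_act.
- exact: comonoid_morphism_eps phiH_comonoid.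
exact: comonoid_morphism_delta phiH_comonoid.
Qed.

Hypothesis psi_lam_H_l :
  (A ⊗ mu H) ∘ (psi ⊗ H) ∘ (lam H ⊗ ((A ⊗ mu H) ∘ (psi ⊗ H))) ∘ (delta H ⊗ A ⊗ H) =
  eps H ⊗ A ⊗ H.
Hypothesis psi_lam_H_r :
  (A ⊗ mu H) ∘ (psi ⊗ H) ∘ (H ⊗ ((A ⊗ mu H) ∘ (psi ⊗ H))) ∘
    (((H ⊗ lam H) ∘ delta H) ⊗ A ⊗ H) =
  eps H ⊗ A ⊗ H.
Hypothesis psi_lam_A_r :
  (mu A ⊗ H) ∘ (A ⊗ psi) ∘ (((mu A ⊗ H) ∘ (A ⊗ psi)) ⊗ lam A) ∘ (A ⊗ H ⊗ delta A) =
  A ⊗ H ⊗ eps A.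
Hypothesis psi_lam_A_l :
  (mu A ⊗ H) ∘ (A ⊗ psi) ∘ (((mu A ⊗ H) ∘ (A ⊗ psi)) ⊗ A) ∘
    (A ⊗ H ⊗ ((lam A ⊗ A) ∘ delta A)) =
  A ⊗ H ⊗ eps A.

Let epsA_act : (eps A ⊗ H) ∘ ((A ⊗ mu H) ∘ (psi ⊗ H)) = mu H ∘ (phiH ⊗ H).
Proof.
rewrite compA // (@interchange _ A K (H ⊗ H) H) // tensm1a -tensm_id tensmA.
by rewrite -compA // -tens_comp1.
Qed.

Let epsH_act : (A ⊗ eps H) ∘ ((mu A ⊗ H) ∘ (A ⊗ psi)) = mu A ∘ (A ⊗ phiA).
Proof.
rewrite compA // -(@interchange _ (A ⊗ A) A H K) // tensma1 -tensm_id -tensmA.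
by rewrite -compA // -tens1_comp.
Qed.

(** Exhibits the left sides of [mp_lam_H_l] and [mp_lam_H_r], for u = λ_H and u = id, as
    H-components of two successive left multiplications by H. [phiA_act] does this for right
    multiplications by A. *)
Let phiH_act u : dom u = H -> cod u = H ->
  mu H ∘ (phiH ⊗ mu H) ∘ (u ⊗ psi ⊗ H) =
  (eps A ⊗ H) ∘ ((A ⊗ mu H) ∘ (psi ⊗ H) ∘ (u ⊗ ((A ⊗ mu H) ∘ (psi ⊗ H)))).
Proof.
move=> *; rewrite [RHS]compA // epsA_act -!compA //; congr (_ ∘ _).
rewrite -[u in RHS](@comp1l _ H) // tensm_comp // compA // tensmA -[in RHS]tensm_comp //.
by rewrite tensm_id comp1l // comp1r // tensmA.
Qed.

Let phiA_act u : dom u = A -> cod u = A ->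
  mu A ∘ (mu A ⊗ phiA) ∘ (A ⊗ psi ⊗ u) =
  (A ⊗ eps H) ∘ ((mu A ⊗ H) ∘ (A ⊗ psi) ∘ (((mu A ⊗ H) ∘ (A ⊗ psi)) ⊗ u)).
Proof.
move=> *; rewrite [RHS]compA // epsH_act -!compA //; congr (_ ∘ _).
rewrite -[u in RHS](@comp1l _ A) // tensm_comp // compA //.
rewrite -(tensmA (mu A) H A) -[in RHS]tensm_comp //.
by rewrite tensm_id comp1l // comp1r.
Qed.

Lemma law_matched_pair : matched_pair A H phiA phiH.
Proof.
split; rewrite ?law_Psi.
- exact: law_left_module.
- exact: law_right_module.
- rewrite -compA // (dl_eta_A law) -tensm_comp // comp1l // comp1r //.
  by rewrite tensm_through_unit // tensm_through_unit'.
- rewrite -compA // (dl_eta_H law) -tensm_comp // comp1l // comp1r //.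
  by rewrite [LHS]tensm_through_unit' // tensm_through_unit.
(* Pairing the components of a comonoid morphism in the opposite order amounts to composing it with
   the braid. *)
- exact: esym (comonoid_morphism_pairing_swap hHA hA hH psi_comonoid).
- by rewrite law_phiA_mu -[LHS]compA // -tensm_comp // comp1l.
- rewrite phiH_act // -compA // psi_lam_H_l.
  by rewrite -tensmA -[eps A ⊗ H]tensm1a -tensm_comp // comp1l // tensm_id comp1r // tensmA.
- rewrite phiH_act // -compA // psi_lam_H_r.
  by rewrite -tensmA -[eps A ⊗ H]tensm1a -tensm_comp // comp1l // tensm_id comp1r // tensmA.
- by rewrite law_phiH_mu -compA // -[_ ⊗ lam H ⊗ lam A]tensmA -tensm_comp // comp1l.
- rewrite phiA_act // -compA // psi_lam_A_r.
  by rewrite -[A ⊗ eps H in LHS]tensma1 -tensm_comp // comp1l // tensm_id comp1r.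
rewrite phiA_act // -compA // psi_lam_A_l.
by rewrite -[A ⊗ eps H in LHS]tensma1 -tensm_comp // comp1l // tensm_id comp1r.
Qed.

End LawMatchedPair.

(** * From a matched pair to a factorization *)

Section MatchedPairLaw.
Variables (C : ssm_category) (A H : hopf_quasigroup C) (phiA phiH : arr C).
Hypotheses (lamH : isomorphism H H (lam H)) (lamA : isomorphism A A (lam A)).
Hypothesis mp : matched_pair A H phiA phiH.

Let hA : comonoid A := hopf_comonoidP A.
Let hH : comonoid H := hopf_comonoidP H.
Let hK := unit_comonoidP C.
Let hHA := tens_comonoidP hH hA.
Let hAH := tens_comonoidP hA hH.
Let idA := comonoid_morphism_id hA.
Let idH := comonoid_morphism_id hH.
Let etaA := eta_comonoid_morphism A.
Let etaH := eta_comonoid_morphism H.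

Local Notation psi := (Psi A H phiA phiH).

Let phiA_comonoid : comonoid_morphism (tens_comonoid H A) A phiA.
Proof. by case: (mp_left mp) => *; split. Qed.

Let phiH_comonoid : comonoid_morphism (tens_comonoid H A) H phiH.
Proof. by case: (mp_right mp) => *; split. Qed.

(** The axiom [mp_braid] is exactly the condition under which a pairing of two comonoid morphisms is
    again one. *)
Let psi_comonoid : comonoid_morphism (tens_comonoid H A) (tens_comonoid A H) psi.
Proof. exact: (pairing_morphism hHA hA hH phiA_comonoid phiH_comonoid (mp_braid mp)). Qed.

Let projA_psi : (A ⊗ eps H) ∘ psi = phiA.
Proof. exact: (proj_pairing_l hHA hH phiA_comonoid phiH_comonoid). Qed.

Let projH_psi : (eps A ⊗ H) ∘ psi = phiH.
Proof. exact: (proj_pairing_r hHA hA phiA_comonoid phiH_comonoid). Qed.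

Let mu_A_act : phiA ∘ (H ⊗ mu A) = mu A ∘ (A ⊗ phiA) ∘ (psi ⊗ A).
Proof.
apply: (iso_cancelr (isomorphism_tens (isomorphism_tens lamH lamA) (isomorphism_id A))) => //.
by rewrite (mp_mu_A mp) tens_comp1 // compA.
Qed.

Let mu_H_act : phiH ∘ (mu H ⊗ A) = mu H ∘ (phiH ⊗ H) ∘ (H ⊗ psi).
Proof.
apply: (iso_cancelr (isomorphism_tens (isomorphism_id H) (isomorphism_tens lamH lamA))) => //.
by rewrite tensmA (mp_mu_H mp) tens1_comp // compA // tensmA.
Qed.

(** In each equation both sides are comonoid morphisms into A ⊗ H, so their two components can be
    compared separately. *)
Lemma matched_pair_law : distributive_law A H psi.
Proof.
split=> //.
- apply: (eq_comonoid_morphism hA hA hH).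
  + apply: comonoid_morphism_comp psi_comonoid _ => //.
    rewrite -[X in comonoid_morphism X](tens_comonoid1o hA).
    exact: comonoid_morphism_tens.
  + rewrite -[X in comonoid_morphism X](tens_comonoido1 hA).
    exact: comonoid_morphism_tens.
  + rewrite compA // projA_psi (lmod_eta (mp_left mp)) -tensm_comp // comp1l //.
    by rewrite eps_eta tensma1.
  rewrite compA // projH_psi (mp_eta_H mp) -tensm_comp // comp1l // comp1r //.
  by rewrite [RHS]tensm_through_unit' // tensm_through_unit.
- apply: (eq_comonoid_morphism hH hA hH).
  + apply: comonoid_morphism_comp psi_comonoid _ => //.
    rewrite -[X in comonoid_morphism X](tens_comonoido1 hH).
    exact: comonoid_morphism_tens.
  + rewrite -[X in comonoid_morphism X](tens_comonoid1o hH).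
    exact: comonoid_morphism_tens.
  + rewrite compA // projA_psi (mp_eta_A mp) -tensm_comp // comp1l // comp1r //.
    by rewrite [LHS]tensm_through_unit' // tensm_through_unit.
  rewrite compA // projH_psi (rmod_eta (mp_right mp)) -tensm_comp // comp1l //.
  by rewrite eps_eta tensm1a.
- have hHH := tens_comonoidP hH hH.
  apply: (eq_comonoid_morphism (tens_comonoidP hHH hA) hA hH).
  + apply: comonoid_morphism_comp psi_comonoid _ => //; first exact: tens_comonoidP.
    apply: comonoid_morphism_tens => //; exact: mu_comonoid_morphism.
  (* The composite runs through (H ⊗ A) ⊗ H and (A ⊗ H) ⊗ H; after reassociation each stage is a
     tensor product of comonoid morphisms. *)
  + apply: (@comonoid_morphism_comp _ _ (tens_comonoid (tens_comonoid H A) H)) => //.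
    * exact: tens_comonoidP.
    * exact: tens_comonoidP.
    * apply: (@comonoid_morphism_comp _ _ (tens_comonoid (tens_comonoid A H) H)) => //.
      - exact: tens_comonoidP.
      - exact: tens_comonoidP.
      - rewrite -tens_comonoidA //.
        apply: comonoid_morphism_tens => //; exact: mu_comonoid_morphism.
      exact: comonoid_morphism_tens.
    rewrite -!tens_comonoidA //; exact: comonoid_morphism_tens.
  + rewrite projA_mu_H // projA_psi compA // projA_psi.
    exact: esym (lmod_mu (mp_left mp)).
  (* The equation left over is [mu_H_act], already in the context. *)
  by rewrite projH_mu_H // projH_psi compA // projH_psi.
have hAA := tens_comonoidP hA hA.
apply: (eq_comonoid_morphism (tens_comonoidP hH hAA) hA hH).
- apply: comonoid_morphism_comp psi_comonoid _ => //; first exact: tens_comonoidP.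
  apply: comonoid_morphism_tens => //; exact: mu_comonoid_morphism.
- apply: (@comonoid_morphism_comp _ _ (tens_comonoid A (tens_comonoid H A))) => //.
  + exact: tens_comonoidP.
  + exact: tens_comonoidP.
  + apply: (@comonoid_morphism_comp _ _ (tens_comonoid A (tens_comonoid A H))) => //.
    * exact: tens_comonoidP.
    * exact: tens_comonoidP.
    * rewrite tens_comonoidA //.
      apply: comonoid_morphism_tens => //; exact: mu_comonoid_morphism.
    exact: comonoid_morphism_tens.
  rewrite !tens_comonoidA //; exact: comonoid_morphism_tens.
(* The equation left over is [mu_A_act], already in the context. *)
- by rewrite projA_mu_A // projA_psi compA // projA_psi.
rewrite projH_mu_A // projH_psi compA // projH_psi.
exact: esym (rmod_mu (mp_right mp)).
Qed.

End MatchedPairLaw.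

(** * Partial associativity in the double cross product *)

Section DoubleCrossProduct.
Variables (C : ssm_category) (A H : hopf_quasigroup C) (phiA phiH : arr C).
Local Notation psi := (Psi A H phiA phiH).
Local Notation Y := (double_cross_product A H phiA phiH).
Hypothesis law : distributive_law A H psi.

Let hA : comonoid A := hopf_comonoidP A.
Let hH : comonoid H := hopf_comonoidP H.
Let hK := unit_comonoidP C.
Let hom_psi : hom (H ⊗ A) (A ⊗ H) psi := comonoid_morphism_hom (dl_comonoid law).

Local Notation "p ⋆ q" := (mu Y ∘ (p ⊗ q)) (at level 42, left associativity).
Local Notation AH := (idm (tens A H)).
Local Notation jA := (A ⊗ eta H).
Local Notation jH := (eta A ⊗ H).

(** The unit of H beside ψ makes ψ trivial by [dl_eta_H]. This lemma and the next three put a unit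
    in each of the four slots of a product (ah)(bk). *)
Lemma dcp_jA_id : jA ⋆ AH = mu A ⊗ H.
Proof.
rewrite /= -compA // -tensm_id tensmA.
have -> : (A ⊗ psi ⊗ H) ∘ (A ⊗ eta H ⊗ A ⊗ H) = A ⊗ A ⊗ eta H ⊗ H.
  by rewrite -tensm_comp // -!(tensmA A) -tensm_comp // (dl_eta_H law) !comp1l // !tensmA.
by rewrite -!tensmA tensmA -tensm_comp // mul_eta_l // tensm_id comp1r.
Qed.

Lemma dcp_jH_id : jH ⋆ AH = (A ⊗ mu H) ∘ (psi ⊗ H).
Proof.
rewrite /= -compA // -tensm_id tensmA.
have -> : (A ⊗ psi ⊗ H) ∘ (eta A ⊗ H ⊗ A ⊗ H) = (eta A ⊗ A ⊗ H ⊗ H) ∘ (psi ⊗ H).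
  have := @interchange _ K A (H ⊗ A ⊗ H) (A ⊗ H ⊗ H) (eta A) (psi ⊗ H).
  by rewrite -!tensm_id !tensmA tensm1a => ->.
by rewrite compA // -!tensmA tensmA -tensm_comp // mul_eta_l // tensm_id comp1r.
Qed.

Lemma dcp_id_jA : AH ⋆ jA = (mu A ⊗ H) ∘ (A ⊗ psi).
Proof.
rewrite /= -compA // -tensm_id tensmA.
have -> : (A ⊗ psi ⊗ H) ∘ (A ⊗ H ⊗ A ⊗ eta H) = (A ⊗ A ⊗ H ⊗ eta H) ∘ (A ⊗ psi).
  have := @interchange _ (A ⊗ H ⊗ A) (A ⊗ A ⊗ H) K H (A ⊗ psi) (eta H).
  by rewrite -!tensm_id tensma1 => ->.
by rewrite compA // -!tensmA tensmA -tensm_comp // mul_eta_r // tensm_id comp1r.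
Qed.

Lemma dcp_id_jH : AH ⋆ jH = A ⊗ mu H.
Proof.
rewrite /= -compA // -tensm_id tensmA.
have -> : (A ⊗ psi ⊗ H) ∘ (A ⊗ H ⊗ eta A ⊗ H) = A ⊗ eta A ⊗ H ⊗ H.
  by rewrite -tensm_comp // -!(tensmA A) -tensm_comp // (dl_eta_A law) !comp1l // !tensmA.
by rewrite -!tensmA tensmA -tensm_comp // mul_eta_r // tensm_id comp1r.
Qed.

Lemma dcp_jA_mul r : cod r = (A ⊗ H)%ob -> jA ⋆ r = (mu A ⊗ H) ∘ (A ⊗ r).
Proof.
move=> hr; rewrite -dcp_jA_id -[RHS]compA //.
by rewrite -[X in _ = _ ∘ X]tensm_comp // comp1r // comp1l.
Qed.

Lemma dcp_jH_mul r : cod r = (A ⊗ H)%ob ->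
  jH ⋆ r = (A ⊗ mu H) ∘ (psi ⊗ H) ∘ (H ⊗ r).
Proof.
move=> hr; rewrite -dcp_jH_id -[RHS]compA //.
by rewrite -[X in _ = _ ∘ X]tensm_comp // comp1r // comp1l.
Qed.

Lemma dcp_mul_jA r : cod r = (A ⊗ H)%ob ->
  r ⋆ jA = (mu A ⊗ H) ∘ (A ⊗ psi) ∘ (r ⊗ A).
Proof.
move=> hr; rewrite -dcp_id_jA -[RHS]compA //.
by rewrite -[X in _ = _ ∘ X]tensm_comp // comp1r // comp1l.
Qed.

Lemma dcp_mul_jH r : cod r = (A ⊗ H)%ob -> r ⋆ jH = (A ⊗ mu H) ∘ (r ⊗ H).
Proof.
move=> hr; rewrite -dcp_id_jH -[RHS]compA //.
by rewrite -[X in _ = _ ∘ X]tensm_comp // comp1r // comp1l.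
Qed.

Lemma dcp_jA_jH : jA ⋆ jH = AH.
Proof.
by rewrite dcp_jA_mul // tensmA -tensm_comp // mul_eta_r // comp1l // tensm_id.
Qed.

Lemma dcp_jH_jA : jH ⋆ jA = psi.
Proof.
rewrite dcp_jH_mul // -compA // tensmA tensm_id.
rewrite (@interchange _ (H ⊗ A) (A ⊗ H) K H psi (eta H)) // tensma1 compA //.
by rewrite -tensm_id -tensmA -tensm_comp // mul_eta_r // comp1l // tensm_id comp1l.
Qed.

(** (ah)y = a(hy) follows from the shape of the product and the unit axioms; multiplicativity of ψ
    enters only for the products ha below. *)
Lemma dcp_assoc_AHx : AH ⋆ AH = jA ⋆ (jH ⋆ AH).
Proof.
rewrite dcp_jA_mul // dcp_jH_id tens1_comp // compA //= tensmA -tensmA.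
rewrite tensm_id comp1r //; congr (_ ∘ _).
by rewrite -tensm_comp // tensm_id comp1r // comp1l.
Qed.

Lemma dcp_assoc_xAH : AH ⋆ AH = (AH ⋆ jA) ⋆ jH.
Proof.
rewrite dcp_mul_jH // dcp_id_jA tens_comp1 // compA //= -tensmA.
rewrite tensm_id comp1r //; congr (_ ∘ _).
by rewrite -tensmA -tensm_comp // tensm_id comp1r // comp1l.
Qed.

(** (ha)y = h(ay) is [dl_mu_A] tensored with H and followed by the product of H; [dcp_assoc_xHA] is
    the mirror image, from [dl_mu_H]. *)
Lemma dcp_assoc_HAx : psi ⋆ AH = jH ⋆ (jA ⋆ AH).
Proof.
rewrite dcp_jH_mul // dcp_jA_id /=.
rewrite -[RHS]compA // tensmA -[in RHS]tens_comp1 // (dl_mu_A law).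
rewrite -[in RHS]compA // tens_comp1 // [RHS]compA // -[LHS]compA //.
rewrite -tensm_id tensmA -tens_comp1 //; congr (_ ∘ _).
by rewrite -tensmA -tensm_comp // tensm_id comp1r // comp1l.
Qed.

Lemma dcp_assoc_xHA : AH ⋆ psi = (AH ⋆ jH) ⋆ jA.
Proof.
rewrite dcp_mul_jA // dcp_id_jH /=.
rewrite -[RHS]compA // -[A ⊗ mu H ⊗ A]tensmA -[in RHS]tens1_comp // (dl_mu_H law).
rewrite -[in RHS]compA // tens1_comp // [RHS]compA // -[LHS]compA //.
rewrite -tensm_id -!tensmA -tens1_comp //; congr (_ ∘ _).
by rewrite tensmA -tensm_comp // tensm_id comp1r // comp1l.
Qed.

Lemma dcp_jA_morphism : hopf_morphism A Y jA.
Proof.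
split.
  split=> //; first by rewrite /= [RHS](@tensm_rl _ A K) // tensma1.
  rewrite dcp_jA_mul // tensmA tensm_id (@interchange _ (A ⊗ A) A K H) //.
  by rewrite tensma1.
rewrite -[X in comonoid_morphism X](tens_comonoido1 hA).
apply: (@comonoid_morphism_tens _ A A (unit_comonoid C) H) => //.
  exact: comonoid_morphism_id.
exact: eta_comonoid_morphism.
Qed.

Lemma dcp_jH_morphism : hopf_morphism H Y jH.
Proof.
split.
  split=> //; first by rewrite /= [RHS](@tensm_lr _ K H) // tensm1a.
  rewrite dcp_mul_jH // -tensmA tensm_id -(@interchange _ K A (H ⊗ H) H) //.
  by rewrite tensm1a.
rewrite -[X in comonoid_morphism X](tens_comonoid1o hH).
apply: (@comonoid_morphism_tens _ (unit_comonoid C) A H H) => //.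
  exact: eta_comonoid_morphism.
exact: comonoid_morphism_id.
Qed.

(** * Transport of the factorization along an isomorphism *)

Section Transport.
Variables (X : hopf_quasigroup C) (f g : arr C).
Hypotheses (hg : hopf_morphism Y X g) (hf : hom X Y f).
Hypotheses (gf : g ∘ f = idm X) (fg : f ∘ g = idm Y).

Local Notation "p • q" := (mu X ∘ (p ⊗ q)) (at level 42, left associativity).

Let hX : comonoid X := hopf_comonoidP X.
Let hY : comonoid Y := tens_comonoidP hA hH.
Let g_magma : magma_morphism Y X g := proj1 hg.

Let g_iso : isomorphism (A ⊗ H) X g.
Proof. by split=> //; exists f. Qed.

Let g_mul p q : cod p = (A ⊗ H)%ob -> cod q = (A ⊗ H)%ob ->
  (g ∘ p) • (g ∘ q) = g ∘ (p ⋆ q).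
Proof. by move=> *; rewrite tensm_comp // compA // -(magma_morphism_mu g_magma) compA. Qed.

Let iA := g ∘ jA.
Let iH := g ∘ jH.

Let hom_iA : hom A X iA. Proof. by rewrite /iA. Qed.
Let hom_iH : hom H X iH. Proof. by rewrite /iH. Qed.

Let omegaE : omega X iA iH = g.
Proof. by rewrite /omega g_mul // dcp_jA_jH comp1r. Qed.

Let thetaE : theta X iA iH = g ∘ psi.
Proof. by rewrite /theta g_mul // dcp_jH_jA. Qed.

(** For these inclusions ω is [g] and θ is [g ∘ psi]. Precomposing the slot of X with the
    isomorphism [g] turns each associativity condition into one of the four proved in the double
    cross product. *)
Lemma double_cross_product_factorization : factorization X A H iA iH.
Proof.
split; rewrite ?omegaE ?thetaE //.
(* The inclusion is split by going back to A ⊗ H and applying the counit of H. *)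
- apply: (@monomorphism_retract _ _ _ _ ((A ⊗ eps H) ∘ f)) => //.
  rewrite /iA -compA // (compA (f := jA)) // fg comp1l // -tensm_comp //.
  by rewrite eps_eta comp1l // tensma1.
- exact: hopf_morphism_comp dcp_jA_morphism.
- apply: (@monomorphism_retract _ _ _ _ ((eps A ⊗ H) ∘ f)) => //.
  rewrite /iH -compA // (compA (f := jH)) // fg comp1l // -tensm_comp //.
  by rewrite eps_eta comp1l // tensm1a.
- exact: hopf_morphism_comp dcp_jH_morphism.
- apply: (iso_cancelr (isomorphism_tens (isomorphism_id (A ⊗ H)) g_iso)) => //.
  rewrite -[in RHS]tensm_id -[in RHS]tensmA !prod_comp // !comp1l // !comp1r //.
  rewrite -[in LHS](@comp1r _ (A ⊗ H) g) // g_mul // dcp_assoc_AHx.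
  by rewrite -!g_mul // comp1r.
- apply: (iso_cancelr (isomorphism_tens g_iso (isomorphism_id (A ⊗ H)))) => //.
  rewrite -[in RHS]tensm_id tensmA !prod_comp // !comp1l // !comp1r //.
  rewrite -[in LHS](@comp1r _ (A ⊗ H) g) // g_mul // dcp_assoc_xAH.
  by rewrite -!g_mul // comp1r.
- apply: (iso_cancelr (isomorphism_tens (isomorphism_id (H ⊗ A)) g_iso)) => //.
  rewrite -[in RHS]tensm_id -[in RHS]tensmA !prod_comp // !comp1l // !comp1r //.
  (* The antipodes are factored out to the right, the untwisted identity is applied, and they are
     composed back in. *)
  rewrite -(@prod_compl _ X (g ∘ psi) g _ (A ⊗ H)) //.
  rewrite -{2}[g](@comp1r _ (A ⊗ H)) // g_mul // dcp_assoc_HAx.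
  by rewrite -!g_mul // comp1r // -(tensmA (lam H)) !prod_comp // comp1r.
apply: (iso_cancelr (isomorphism_tens g_iso (isomorphism_id (H ⊗ A)))) => //.
rewrite -[in RHS]tensm_id tensmA !prod_comp // !comp1l // !comp1r //.
rewrite -(@prod_compr _ X g (g ∘ psi) _ (A ⊗ H)) //.
rewrite -{1}[g](@comp1r _ (A ⊗ H)) // g_mul // dcp_assoc_xHA.
by rewrite -!g_mul // comp1r // (tensmA _ (lam H)) !prod_comp // comp1r.
Qed.
End Transport.

End DoubleCrossProduct.

(** * Both directions of the equivalence *)

Theorem theorem4p6 (C : ssm_category) (H A X : hopf_quasigroup C) :
  isomorphism H H (lam H) -> isomorphism A A (lam A) ->
  (factorizes X A H <->
   exists phiA phiH : arr C,
     matched_pair A H phiA phiH /\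
     hopf_isomorphic X (double_cross_product A H phiA phiH)).
Proof.
move=> lamH lamA.
have [hA hH hX] := And3 (hopf_comonoidP A) (hopf_comonoidP H) (hopf_comonoidP X).
have [hAH hHA] := conj (tens_comonoidP hA hH) (tens_comonoidP hH hA).
split=> [[iA [iH fac]] | [phiA [phiH [mp [f [g [hf hg gf fg]]]]]]].
  have om_comonoid := omega_comonoid fac.
  have [w [hom_w w_om om_w]] := proj2 (omega_iso fac).
  set psi := w ∘ theta X iA iH.
  have th_comonoid := theta_comonoid fac.
  have psi_comonoid : comonoid_morphism (tens_comonoid H A) (tens_comonoid A H) psi.
    apply: comonoid_morphism_comp th_comonoid => //.
    exact: (comonoid_morphism_inv _ _ om_comonoid).
  have om_psi : omega X iA iH ∘ psi = theta X iA iH.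
    by rewrite compA // om_w comp1l.
  have law := factorization_law lamH lamA fac psi_comonoid om_psi.
  have mp := law_matched_pair law
    (factorization_lam_H_l fac psi_comonoid om_psi)
    (factorization_lam_H_r fac psi_comonoid om_psi)
    (factorization_lam_A_r fac psi_comonoid om_psi)
    (factorization_lam_A_l fac psi_comonoid om_psi).
  exists ((A ⊗ eps H) ∘ psi), ((eps A ⊗ H) ∘ psi); split=> //.
  set Y := double_cross_product _ _ _ _.
  (* The product of [Y] is built from [Psi] of the two components, which [law_Psi] identifies with
     [psi]. *)
  have YE : mu Y = (mu A ⊗ mu H) ∘ (A ⊗ psi ⊗ H) by rewrite /= law_Psi.
  have om_hopf : hopf_morphism Y X (omega X iA iH).
    split=> //; split=> //; first exact: omega_eta.
    by rewrite YE (omega_mu fac psi_comonoid om_psi).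
  exists w, (omega X iA iH); split=> //.
  by apply: (@hopf_morphism_inv _ Y X (omega X iA iH)) => //; rewrite YE.
have hom_g : hom (A ⊗ H) X g := magma_morphism_hom (proj1 hg).
(* The inclusions are the canonical ones a ↦ a ⊗ 1 and h ↦ 1 ⊗ h, carried to X by [g]. *)
exists (g ∘ (A ⊗ eta H)), (g ∘ (eta A ⊗ H)).
apply: (double_cross_product_factorization (matched_pair_law lamH lamA mp) hg _ gf fg).
exact: magma_morphism_hom (proj1 hf).
Qed.
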